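(* For any $L\ge\mu>0$ with $L>10\mu$, there exists an $L$-smooth $\mu$-strongly convex decentralized problem $\mathcal{DP}$ with sufficiently large $\chi(\mathcal{DP})=\chi$ and $n(\mathcal{DP})=n$ (i.e. larger than any prescribed bound), such that $\Delta(\mathcal{DP})\le 12\log_2 n$ and, for any first-order decentralized algorithm, the number of communication rounds needed to find an $\varepsilon$-accurate solution of $\min_x f(x)$ is lower bounded by $$\Omega\left(\frac{\chi}{\log\chi}\sqrt{L/\mu}\,\log\frac1\varepsilon\right).$$
   Context: $\mathbb{N}=\{1,2,\dots\}$. All objective functions are defined on the Hilbert space $\ell_2$ with its usual norm $\|\cdot\|$. A differentiable function $h$ is $L$-smooth if $\|\nabla h(y)-\nabla h(x)\|\le L\|y-x\|$ for all $x,y$, and $\mu$-strongly convex if $h(y)\ge h(x)+\langle\nabla h(x),y-x\rangle+\frac{\mu}{2}\|y-x\|^2$ for all $x,y$. Decentralized problem. A decentralized time-varying problem $\mathcal{DP}$ is a pair $(\{\mathcal G_k\}_{k=1}^\infty,\{f_i\}_{i=1}^n)$, where $\mathcal G_k=(\mathcal V,\mathcal E_k)$ are undirected connected graphs on the common vertex set $\mathcal V=\{1,\dots,n\}$, and $f_i$ is a convex function with Lipschitz gradient held by node $i$. Set $f(x)=\frac1n\sum_{i=1}^n f_i(x)$ (the global function); $\mathcal{DP}$ is called $L$-smooth (resp. $\mu$-strongly convex) if $f$ is. Let $x_*$ denote the minimizer of $f$. Put $n(\mathcal{DP})=n$. For a connected graph $\mathcal G$, let $\chi(\mathcal G)=\lambda_{\max}/\lambda_{\min}^+$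 be the ratio of the largest to the smallest nonzero eigenvalue of the graph Laplacian (degree matrix minus adjacency matrix) of $\mathcal G$, and put $\chi(\mathcal{DP})=\sup_k\chi(\mathcal G_k)$. Put $\Delta(\mathcal{DP})=\max_{k\in\mathbb N}|(\mathcal E_k\setminus\mathcal E_{k+1})\cup(\mathcal E_{k+1}\setminus\mathcal E_k)|$, the maximum number of edges changed between consecutive communication rounds. First-order decentralized algorithm. Each node $i$ has a local memory $\mathcal H_i(k)\subseteq\ell_2$ at time step $k=0,1,2,\dots$, with $\mathcal H_i(0)=\{x_0\}$, $x_0=0$. At each time step $k$ the algorithm performs one of the following. (1) A local computation: $\mathcal H_i(k+1)\subseteq\mathrm{span}\{x,\nabla f_i(x),\nabla f_i^*(x):x\in\mathcal H_i(k)\}$ for all $i$, where $f_i^*$ is the convex conjugate of $f_i$. (2) A communication round: $\mathcal H_i(k+1)\subseteq\mathrm{span}\big(\bigcup_{j\in\mathcal N_i^{q}\cup\{i\}}\mathcal H_j(k)\big)$ for all $i$, where this is the $q$-th communication round performed and $\mathcal N_i^{q}$ is the set of neighbors of $i$ in $\mathcal G_q$. An $\varepsilon$-accurate solution is a point $x$ (in the memory of some node) with $\|x-x_*\|^2\le\varepsilon$. The notation $\Omega(\cdot)$ is asymptotic as $\varepsilon\to0$ (for all sufficiently small $\varepsilon$), with a hidden positive absolute constant. *)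

(* Defs.v *)
From HB Require Import structures.
From mathcomp Require Import all_boot all_order all_algebra.
From mathcomp Require Import all_classical all_reals all_analysis.
From mathcomp Require Import ring.

Set Implicit Arguments.
Unset Strict Implicit.
Unset Printing Implicit Defensive.

Import Order.TTheory GRing.Theory Num.Theory.
Import numFieldNormedType.Exports.

Local Open Scope classical_set_scope.
Local Open Scope ring_scope.

Section SquareSummable.
Variable R : realType.
Implicit Types x y : nat -> R.

Definition square_summable : {pred nat -> R} :=
  [pred x : nat -> R | `[< cvgn (series (fun n => x n ^+ 2)) >]].

Lemma square_summableP x :
  reflect (cvgn (series (fun n => x n ^+ 2))) (x \in square_summable).
Proof. exact: asboolP. Qed.

Lemma is_cvg_series_mul x y : x \in square_summable -> y \in square_summable ->
  cvgn (series (fun n => x n * y n)).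
Proof.
move=> /square_summableP cx /square_summableP cy.
apply: normed_cvg.
apply: (@series_le_cvg _ _ (fun n => x n ^+ 2 + y n ^+ 2)) => [n|n|n|].
- exact: normr_ge0.
- by rewrite addr_ge0 ?sqr_ge0.
- rewrite /= normrM -(real_normK (num_real (x n))) -(real_normK (num_real (y n))).
  have := sqr_ge0 (`|x n| - `|y n|); rewrite sqrrB => h.
  have h2 : 0 <= `|x n| * `|y n| by rewrite mulr_ge0.
  rewrite addrAC subr_ge0 mulr2n in h.
  by apply: le_trans h; rewrite lerDl.
- exact: (is_cvg_seriesD cx cy).
Qed.

Lemma square_summable_submod_closed : submod_closed square_summable.
Proof.
split.
  apply/square_summableP.
  rewrite (_ : (fun n => _) = cst 0); last by apply/funext => n; rewrite /= expr0n.
  rewrite (_ : series _ = cst 0); first exact: is_cvg_cst.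
  by apply/funext => n; rewrite /series /= big1.
move=> a x y xS yS; apply/square_summableP.
have cxy := is_cvg_series_mul xS yS.
move/square_summableP : xS => cx; move/square_summableP : yS => cy.
have -> : (fun n => ((a *: x + y) n) ^+ 2) =
    (a ^+ 2 *: (fun n => x n ^+ 2) + ((a *+ 2) *: (fun n => x n * y n))
      + (fun n => y n ^+ 2)).
  apply/funext => n.
  by rewrite /= !fctE /GRing.scale /=; ring.
apply: is_cvg_seriesD => //; apply: is_cvg_seriesD; exact: is_cvg_seriesZ.
Qed.

HB.instance Definition _ :=
  GRing.isSubmodClosed.Build R (nat -> R) square_summable
    square_summable_submod_closed.

End SquareSummable.

Record ell2 (R : realType) := Ell2 {
  ell2_seq :> nat -> R;
  ell2P : ell2_seq \in @square_summable R }.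

Section Ell2.
Variable R : realType.

HB.instance Definition _ := [isSub for @ell2_seq R].
HB.instance Definition _ := [Choice of ell2 R by <:].
HB.instance Definition _ := [SubChoice_isSubLmodule of ell2 R by <:].

Implicit Types x y z : ell2 R.

Definition dot x y : R := limn (series (fun n => x n * y n)).

Lemma is_cvg_dot x y : cvgn (series (fun n => x n * y n)).
Proof. by apply: is_cvg_series_mul; exact: ell2P. Qed.

Lemma dotC x y : dot x y = dot y x.
Proof. by congr (limn (series _)); apply/funext => n; rewrite mulrC. Qed.

Lemma dotDl x y z : dot (x + y) z = dot x z + dot y z.
Proof.
rewrite /dot -(lim_seriesD (@is_cvg_dot x z) (@is_cvg_dot y z)).
by congr (limn (series _)); apply/funext => n; rewrite /= !fctE mulrDl.
Qed.

Lemma dotZl a x y : dot (a *: x) y = a * dot x y.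
Proof.
rewrite /dot -[RHS](lim_seriesZ a (@is_cvg_dot x y)).
by congr (limn (series _)); apply/funext => n; rewrite /= !fctE -mulrA.
Qed.

Lemma dotDr x y z : dot z (x + y) = dot z x + dot z y.
Proof. by rewrite dotC dotDl !(dotC z). Qed.

Lemma dotZr a x y : dot x (a *: y) = a * dot x y.
Proof. by rewrite dotC dotZl dotC. Qed.

Lemma dot_ge_term x n : x n ^+ 2 <= dot x x.
Proof.
have nd : nondecreasing_seq (series (fun n => x n * x n)).
  by apply: nondecreasing_series => k _ _; rewrite -expr2 sqr_ge0.
have := nondecreasing_cvgn_le nd (@is_cvg_dot x x) n.+1.
apply: le_trans; rewrite /series /= big_nat_recr //= expr2 lerDr.
by apply: sumr_ge0 => k _; rewrite -expr2 sqr_ge0.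
Qed.

Lemma dot_ge0 x : 0 <= dot x x.
Proof. exact: le_trans (sqr_ge0 _) (dot_ge_term x 0). Qed.

Lemma dot_eq0 x : dot x x = 0 -> x = 0.
Proof.
move=> x0; apply/val_inj/funext => n; apply/eqP => /=.
have : x n ^+ 2 <= 0 by rewrite -x0 dot_ge_term.
by rewrite le_eqVlt ltNge sqr_ge0 orbF sqrf_eq0.
Qed.

Lemma dot_CauchySchwarz x y : dot x y ^+ 2 <= dot x x * dot y y.
Proof.
have [y0|yN0] := eqVneq (dot y y) 0.
  have -> : y = 0 *: y by rewrite (dot_eq0 y0) scaler0.
  by rewrite !dotZr dotZl !mul0r mulr0 expr0n.
have yp : 0 < dot y y by rewrite lt_neqAle eq_sym yN0 dot_ge0.
have := dot_ge0 (dot y y *: x + (- dot x y) *: y).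
rewrite !(dotDl, dotDr, dotZl, dotZr) (dotC y x) => h.
rewrite -subr_ge0 -(pmulr_rge0 _ yp); apply: le_trans h _.
by rewrite le_eqVlt; apply/orP; left; apply/eqP; ring.
Qed.

Definition ell2_norm x : R := Num.sqrt (dot x x).

Lemma ell2_normD x y : ell2_norm (x + y) <= ell2_norm x + ell2_norm y.
Proof.
have h0 : 0 <= ell2_norm x + ell2_norm y by rewrite addr_ge0 ?sqrtr_ge0.
rewrite -(ger0_norm h0) -sqrtr_sqr ler_wsqrtr // sqrrD !sqr_sqrtr ?dot_ge0 //.
rewrite dotDl !dotDr (dotC y x) addrA lerD2r -addrA lerD2l -mulr2n lerMn2r.
rewrite -sqrtrM ?dot_ge0 //; apply: le_trans (ler_norm _) _.
by rewrite -sqrtr_sqr ler_wsqrtr // dot_CauchySchwarz.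
Qed.

Lemma ell2_normZ a x : ell2_norm (a *: x) = `|a| * ell2_norm x.
Proof.
by rewrite /ell2_norm dotZl dotZr mulrA -expr2 sqrtrM ?sqr_ge0 // sqrtr_sqr.
Qed.

Lemma ell2_norm_eq0 x : ell2_norm x = 0 -> x = 0.
Proof.
move=> /eqP; rewrite sqrtr_eq0 => h; apply: dot_eq0.
by apply/eqP; rewrite eq_le h dot_ge0.
Qed.

HB.instance Definition _ := Lmodule_isNormed.Build R (ell2 R)
  ell2_normD ell2_normZ ell2_norm_eq0.

Lemma ell2_normE x : `|x| = Num.sqrt (dot x x).
Proof. by []. Qed.

End Ell2.

Section Functions.
Variable R : realType.
Local Notation H := (ell2 R).
Implicit Types (h : H -> R) (x y g : H).

(* Frechet gradient: the Riesz representative of the differential. *)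
Definition is_gradient h x g : Prop :=
  differentiable (h : H -> R^o) x /\
  forall v, 'd (h : H -> R^o) x v = dot g v.

Definition smooth (L : R) h : Prop :=
  exists2 grad : H -> H, (forall x, is_gradient h x (grad x)) &
    forall x y, `|grad y - grad x| <= L * `|y - x|.

Definition strongly_convex (mu : R) h : Prop :=
  exists2 grad : H -> H, (forall x, is_gradient h x (grad x)) &
    forall x y, h x + dot (grad x) (y - x) + mu / 2 * `|y - x| ^+ 2 <= h y.

Definition convex_conjugate h (y : H) : \bar R :=
  ereal_sup (range (fun x : H => (dot y x - h x)%:E)).

(* An extended-real function has a gradient at x only if it is finite near x. *)
Definition is_egradient (F : H -> \bar R) x g : Prop :=
  (\forall y \near x, F y \is a fin_num) /\ is_gradient (fine \o F) x g.

Definition is_minimizer h x : Prop := forall y, h x <= h y.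

End Functions.

Definition lspan (R : realType) (V : lmodType R) (S : set V) : set V :=
  [set x | exists (m : nat) (a : 'I_m -> R) (v : 'I_m -> V),
     (forall j, S (v j)) /\ x = \sum_j a j *: v j].

Section Graphs.
Variable n : nat.
Implicit Types E : {set {set 'I_n}}.

Definition simple_graph E : Prop := forall e, e \in E -> #|e| = 2%N.

Definition adjacent E : rel 'I_n := fun i j => [set i; j]%SET \in E.

Definition connected_graph E : Prop := forall i j, connect (adjacent E) i j.

Variable R : realType.

Definition adjacency E : 'M[R]_n := \matrix_(i, j) (adjacent E i j)%:R.

Definition degrees E : 'rV[R]_n := \row_i #|[set j | adjacent E i j]%SET|%:R.

Definition laplacian E : 'M[R]_n := diag_mx (degrees E) - adjacency E.

(* Both sets are finite, so sup and inf are a maximum and a minimum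
   (for a connected graph on at least two vertices). *)
Definition lambda_max E : R := sup [set a | eigenvalue (laplacian E) a].

Definition lambda_min_pos E : R :=
  inf [set a | eigenvalue (laplacian E) a /\ a != 0].

Definition graph_chi E : R := lambda_max E / lambda_min_pos E.

End Graphs.

(* Indexing starts at 0: [dp_edges k] is the edge set of the (k+1)-st graph. *)
Record decentralized_problem (R : realType) := DecentralizedProblem {
  dp_n : nat;
  dp_edges : nat -> {set {set 'I_dp_n}};
  dp_fun : 'I_dp_n -> ell2 R -> R;
  dp_simple : forall k, simple_graph (dp_edges k);
  dp_connected : forall k, connected_graph (dp_edges k);
  dp_convex : forall i, convex_function [set: ell2 R] (dp_fun i);
  dp_lipschitz : forall i, exists Li : R, smooth Li (dp_fun i) }.

Section Problems.
Variables (R : realType) (P : decentralized_problem R).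

Definition global_fun (x : ell2 R) : R :=
  (dp_n P)%:R^-1 * \sum_i @dp_fun R P i x.

Definition dp_chi : R := sup (range (fun k => graph_chi R (dp_edges P k))).

Definition edge_changes (k : nat) : nat :=
  #|((dp_edges P k :\: dp_edges P k.+1) :|:
     (dp_edges P k.+1 :\: dp_edges P k))%SET|.

Definition dp_Delta : R := sup (range (fun k => (edge_changes k)%:R : R)).

(* There are finitely many graphs on the vertex set, so the suprema defining
   dp_chi and dp_Delta are over nonempty bounded sets. *)
Lemma dp_chi_has_sup : has_sup (range (fun k => graph_chi R (dp_edges P k))).
Proof.
split; first by exists (graph_chi R (dp_edges P 0)), 0%N.
exists (\sum_(E : {set {set 'I_(dp_n P)}}) `|graph_chi R E|) => _ [k _ <-].
rewrite (bigD1 (dp_edges P k)) //=; apply: le_trans (ler_norm _) _.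
by rewrite lerDl sumr_ge0.
Qed.

Lemma dp_Delta_has_sup : has_sup (range (fun k => (edge_changes k)%:R : R)).
Proof.
split; first by exists (edge_changes 0)%:R, 0%N.
exists #|{set 'I_(dp_n P)}|%:R => _ [k _ <-].
by rewrite ler_nat max_card.
Qed.

End Problems.

Inductive step_kind := LocalComputation | CommunicationRound.

Definition is_comm (s : step_kind) : bool :=
  if s is CommunicationRound then true else false.

(* Counts time steps 0, ..., k-1: the rounds that produced the memory at time k. *)
Definition comm_rounds (step : nat -> step_kind) (k : nat) : nat :=
  \sum_(t < k) is_comm (step t).

Section Updates.
Variables (R : realType) (P : decentralized_problem R).

Definition local_update (i : 'I_(dp_n P)) (M : set (ell2 R)) : set (ell2 R) :=
  lspan [set z | exists2 x, M x &
    [\/ z = x, is_gradient (@dp_fun R P i) x z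
      | is_egradient (convex_conjugate (@dp_fun R P i)) x z]].

Definition comm_update (q : nat) (i : 'I_(dp_n P))
    (M : 'I_(dp_n P) -> set (ell2 R)) : set (ell2 R) :=
  lspan (\bigcup_(j in [set j | j = i \/ adjacent (dp_edges P q) i j]) M j).

End Updates.

(* An execution of a first-order decentralized algorithm on P. The round that
   follows q earlier rounds is the (q+1)-st one and uses [dp_edges P q]. *)
Record algorithm (R : realType) (P : decentralized_problem R) := Algorithm {
  alg_step : nat -> step_kind;
  alg_mem : 'I_(dp_n P) -> nat -> set (ell2 R);
  alg_mem0 : forall i, alg_mem i 0 = [set 0];
  alg_memS : forall k i, alg_mem i k.+1 `<=`
    match alg_step k with
    | LocalComputation => local_update i (alg_mem i k)
    | CommunicationRound =>
        comm_update (comm_rounds alg_step k) i (fun j => alg_mem j k)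
    end }.

(* Main.v *)
Require Import Defs.
From HB Require Import structures.
From mathcomp Require Import all_boot all_order all_algebra.
From mathcomp Require Import all_classical all_reals all_analysis.
From mathcomp Require Import ring lra zify.
Import Order.TTheory GRing.Theory Num.Theory.
Import numFieldNormedType.Exports.
Local Open Scope classical_set_scope.
Local Open Scope ring_scope.

Set Implicit Arguments.
Unset Strict Implicit.
Unset Printing Implicit Defensive.

(* A sequence of bounded-degree trees on [n] vertices makes news travel slowly:
   at any time the vertices split into an initial and a final segment, each
   carrying a binary heap, joined by the edge between the last vertex of the one
   and the first vertex of the other. Every round moves that boundary by one, so
   only [O(1)] edges change and news started at one end of the vertex set follows
   the boundary and needs [n - 1] rounds to reach the other end; then the boundary
   sweeps back. Degrees are bounded and diameters are [O(log n)], so a Poincare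
   inequality along tree paths gives [chi = O(n log n)], and the balanced cut shows
   [chi >= n / 4].

   Nesterov's quadratic chain is split into the two matchings of its coordinates,
   one held by each end vertex, all other nodes holding only the quadratic
   regularizer. A gradient (of a node function or of its conjugate) enlarges the
   leading block of nonzero coordinates by at most one, and only at the end vertex
   whose matching crosses the boundary of the block. Hence each new coordinate
   costs a full sweep, while the minimizer has geometrically decaying coordinates
   of ratio [(sqrt k - 1) / (sqrt k + 1)], [k = L / mu]. *)

(** * Operators on square-summable sequences *)

Section Ell2Theory.
Variable R : realType.
Local Notation H := (ell2 R).
Implicit Types (x y z v g : H) (a : pred nat).

Lemma ell2_ext x y : (forall n, x n = y n) -> x = y.
Proof. by move=> xy; apply/val_inj/funext. Qed.

Lemma ell2DE x y n : (x + y) n = x n + y n. Proof. by []. Qed.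
Lemma ell2NE x n : (- x) n = - x n. Proof. by []. Qed.
Lemma ell2ZE k x n : (k *: x) n = k * x n. Proof. by []. Qed.
Lemma ell20E n : (0 : H) n = 0. Proof. by []. Qed.
Definition ell2E := (ell2DE, ell2NE, ell2ZE, ell20E).

Lemma dotNl x y : dot (- x) y = - dot x y.
Proof. by rewrite -scaleN1r dotZl mulN1r. Qed.

Lemma dotNr x y : dot x (- y) = - dot x y.
Proof. by rewrite dotC dotNl dotC. Qed.

Definition dotE := (@dotDl R, @dotDr R, dotNl, dotNr, @dotZl R, @dotZr R).

Lemma ell2_norm_sqr x : `|x| ^+ 2 = dot x x.
Proof. by rewrite ell2_normE sqr_sqrtr // dot_ge0. Qed.

Lemma ler_ell2_norm x y : dot x x <= dot y y -> `|x| <= `|y|.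
Proof. by move=> xy; rewrite !ell2_normE ler_wsqrtr. Qed.

Lemma normr_dot_le x y : `|dot x y| <= `|x| * `|y|.
Proof.
rewrite !ell2_normE -sqrtrM ?dot_ge0 // -sqrtr_sqr ler_wsqrtr //.
exact: dot_CauchySchwarz.
Qed.

Lemma dot_mul_le x y : 2 * dot x y <= dot x x + dot y y.
Proof. by have := dot_ge0 (x - y); rewrite !dotE (dotC y x); lra. Qed.

Lemma ler_dot x y : (forall n, x n ^+ 2 <= y n ^+ 2) -> dot x x <= dot y y.
Proof.
move=> xy; apply: ler_lim; [exact: is_cvg_dot|exact: is_cvg_dot|].
by apply: nearW => n; apply: ler_sum => i _; rewrite -!expr2.
Qed.

Lemma eq_dot x y x' y' : (forall n, x n * y n = x' n * y' n) -> dot x y = dot x' y'.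
Proof. by move=> e; congr (limn (series _)); apply/funext => n. Qed.

Lemma square_summable_le (u w : nat -> R) : (forall n, u n ^+ 2 <= w n ^+ 2) ->
  w \in @square_summable R -> u \in @square_summable R.
Proof.
move=> uw /square_summableP cw; apply/square_summableP.
by apply: series_le_cvg cw => // n; exact: sqr_ge0.
Qed.

Lemma mask_subproof a x :
  (fun n => if a n then x n else 0) \in @square_summable R.
Proof.
by apply: square_summable_le (ell2P x) => n; case: ifP; rewrite // expr0n sqr_ge0.
Qed.
Definition mask a x : H := Ell2 (mask_subproof a x).

Lemma flip_subproof m x :
  (fun n => if (n < m)%N then x n else - x n) \in @square_summable R.
Proof. by apply: square_summable_le (ell2P x) => n; case: ifP; rewrite ?sqrrN. Qed.
(** An isometric involution fixing exactly the sequences supported on the first [m] coordinates.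
    Functions invariant under it have, at such points, gradients with the same support. *)
Definition flip m x : H := Ell2 (flip_subproof m x).

Lemma shiftl_subproof x : (fun n => x n.+1) \in @square_summable R.
Proof.
apply/square_summableP; have /square_summableP cx := ell2P x.
have -> : series (fun n => x n.+1 ^+ 2) =
  (fun n => series (fun k => x k ^+ 2) n.+1 - x 0 ^+ 2).
  by apply/funext => n; rewrite /series /= big_nat_recl //= addrC addrA addNr add0r.
apply: is_cvgB; last exact: is_cvg_cst.
apply/cvg_ex; exists (limn (series (fun k => x k ^+ 2))).
by rewrite (cvg_shiftS (series (fun k => x k ^+ 2))).
Qed.
Definition shiftl x : H := Ell2 (shiftl_subproof x).

Lemma shiftr_subproof x :
  (fun n => if n is k.+1 then x k else 0) \in @square_summable R.
Proof.
apply/square_summableP; have /square_summableP cx := ell2P x.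
apply/cvg_ex; exists (limn (series (fun k => x k ^+ 2))); rewrite -cvg_shiftS.
rewrite [X in X @ _](_ : _ = series (fun k => x k ^+ 2)) //.
by apply/funext => n; rewrite /series /= big_nat_recl //= expr0n add0r.
Qed.
Definition shiftr x : H := Ell2 (shiftr_subproof x).

Lemma dot_shift x y : dot (shiftl x) y = dot x (shiftr y).
Proof.
rewrite /dot; apply: cvg_lim => //.
have cxy := @is_cvg_dot R x (shiftr y).
rewrite -(cvg_shiftS (series (fun n => x n * shiftr y n))) in cxy.
rewrite (_ : series _ = fun n => series (fun k => x k * shiftr y k) n.+1) //.
by apply/funext => n; rewrite /series /= big_nat_recl //= mulr0 add0r.
Qed.

Lemma dot_mask a x y : dot (mask a x) y = dot x (mask a y).
Proof. by apply: eq_dot => n /=; case: ifP; rewrite ?mul0r ?mulr0. Qed.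

Lemma dot_mask_le a x : dot (mask a x) (mask a x) <= dot x x.
Proof. by apply: ler_dot => n /=; case: ifP; rewrite // expr0n sqr_ge0. Qed.

Lemma dot_shiftr x : dot (shiftr x) (shiftr x) = dot x x.
Proof. by rewrite -dot_shift; congr dot; apply: ell2_ext. Qed.

Lemma dot_shiftl_le x : dot (shiftl x) (shiftl x) <= dot x x.
Proof.
apply: le_trans (dot_mask_le (leq 1) x).
by rewrite dot_shift dot_mask le_eqVlt (eq_dot (x' := x)
  (y' := mask (leq 1) (mask (leq 1) x))) ?eqxx // => -[|n].
Qed.

(* [swap b] exchanges the coordinates 2j and 2j+1 when [b = false], and the
   coordinates 2j+1 and 2j+2 when [b = true]; in that case it kills coordinate 0. *)
Lemma swap_subproof (b : bool) x :
  (fun n => if odd n == b then x n.+1 else if n is k.+1 then x k else 0)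
    \in @square_summable R.
Proof.
rewrite (_ : (fun n => _) = ell2_seq
  (mask (fun n => odd n == b) (shiftl x) + mask (fun n => odd n != b) (shiftr x)));
  first exact: ell2P.
by apply/funext => n; rewrite ell2DE /=; case: eqP; rewrite ?addr0 ?add0r.
Qed.
Definition swap b x : H := Ell2 (swap_subproof b x).

Lemma swap_mask b x : swap b x = mask (fun n => odd n == b) (shiftl x)
  + mask (fun n => odd n != b) (shiftr x).
Proof.
by apply: ell2_ext => n; rewrite ell2E /=; case: eqP; rewrite ?addr0 ?add0r.
Qed.

Lemma swapE b x n : swap b x n =
  if odd n == b then x n.+1 else if n is k.+1 then x k else 0.
Proof. by []. Qed.

Lemma swap_linear b k x y : swap b (k *: x + y) = k *: swap b x + swap b y.
Proof.
apply: ell2_ext => n; rewrite !(swapE, ell2E); case: ifP => // _.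
by case: n => [|n]; rewrite ?ell2E ?mulr0 ?addr0.
Qed.

Lemma swap_sym b x y : dot (swap b x) y = dot x (swap b y).
Proof.
rewrite !swap_mask !dotE !dot_mask dot_shift addrC -[dot (shiftr x) _]dotC -dot_shift.
rewrite [dot (shiftl _) x]dotC; congr (_ + _); congr dot; apply: ell2_ext.
  by move=> n /=; case: (odd _); case: b.
by case=> [|n] /=; [case: ifP|case: (odd _); case: b].
Qed.

(** Split [x] by parity into [u + w]. The two parts of [swap b] contribute equally, so the form is
    twice the product of [u] with a shift of [w], and the shift is a contraction. *)
Lemma swap_le b x : dot (swap b x) x <= dot x x.
Proof.
pose u := mask (fun n => odd n == b) x; pose w := mask (fun n => odd n != b) x.
have xuw : dot x x = dot u u + dot w w.
  rewrite /u /w dot_mask [dot (mask (fun n => odd n != b) _) _]dot_mask -dotDr; congr dot.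
  by apply: ell2_ext => n; rewrite ell2E /=; case: eqP; rewrite /= ?addr0 ?add0r.
have -> : dot (swap b x) x = 2 * dot u (shiftl w).
  rewrite swap_mask dotDl !dot_mask -/u -/w dotC mulr2n mulrDl mul1r; congr (_ + _).
    by apply: eq_dot => n /=; case: (odd _); case: (b); rewrite ?mul0r ?mulr0.
  rewrite [RHS]dotC dot_mask dot_shift dotC; apply: eq_dot => -[|n] /=;
   case: (b) => /=; rewrite ?mul0r ?mulr0 //;
   by case: (odd _) => /=; rewrite ?mul0r ?mulr0.
rewrite xuw; apply: le_trans (dot_mul_le _ _) _; rewrite lerD2l; exact: dot_shiftl_le.
Qed.

Lemma swap_norm b x : `|swap b x| <= 2 * `|x|.
Proof.
rewrite swap_mask; apply: le_trans (ler_normD _ _) _; rewrite mulr2n mulrDl mul1r.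
apply: lerD; apply: ler_ell2_norm; apply: le_trans (dot_mask_le _ _) _.
  exact: dot_shiftl_le.
by rewrite dot_shiftr.
Qed.

Lemma flipE m x n : flip m x n = if (n < m)%N then x n else - x n.
Proof. by []. Qed.

Lemma flip_linear m k x y : flip m (k *: x + y) = k *: flip m x + flip m y.
Proof.
apply: ell2_ext => n; rewrite !ell2E /=; case: ifP => // _.
by rewrite -[X in - X = _]/(k * x n + y n); ring.
Qed.

Lemma flipK m x : flip m (flip m x) = x.
Proof. by apply: ell2_ext => n /=; case: ifP => nm; rewrite nm ?opprK. Qed.

Lemma dot_flip m x y : dot (flip m x) (flip m y) = dot x y.
Proof. by apply: eq_dot => n /=; case: ifP => // _; rewrite mulrNN. Qed.

(** [swap b] pairs [n] with [n.+1] when [odd n = b]. The pair straddling the boundary is [m.-1],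
    [m], which belongs to the other matching. *)
Lemma swap_flip b m x : odd m = b -> swap b (flip m x) = flip m (swap b x).
Proof.
move=> mb; apply: ell2_ext => n; rewrite swapE !flipE swapE.
case: eqP => nb.
  rewrite (_ : (n.+1 < m)%N = (n < m)%N) //.
  by apply/idP/idP; lia.
case: n nb => [|n] nb; first by rewrite oppr0 if_same.
by rewrite flipE (_ : (n.+1 < m)%N = (n < m)%N) //; apply/idP/idP; lia.
Qed.

Definition coords_below m : set H := [set x | forall n, (m <= n)%N -> x n = 0].

Lemma coords_below_flip m x : coords_below m x -> flip m x = x.
Proof.
move=> xm; apply: ell2_ext => n /=; case: ltnP => // /xm ->; exact: oppr0.
Qed.

Lemma coords_below_le m m' : (m <= m')%N -> coords_below m `<=` coords_below m'.
Proof. by move=> mm' x xm n m'n; apply: xm; exact: leq_trans m'n. Qed.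

Lemma coords_below_lspan m (S : set H) :
  S `<=` coords_below m -> lspan S `<=` coords_below m.
Proof.
move=> Sm x [k [c [w [Sw ->]]]] n mn.
suff: forall y, y = \sum_j c j *: w j -> y n = 0 by apply.
move=> y ->; elim/big_ind: _ => // [u u' un u'n|i _]; rewrite ell2E.
  by rewrite un u'n addr0.
by rewrite (Sm _ (Sw i)) // mulr0.
Qed.

Lemma delta_seq_subproof (k : nat) :
  (fun n => (n == k)%:R : R) \in @square_summable R.
Proof.
apply/square_summableP; apply/cvg_ex; exists 1; apply/cvg_ballP => e e0.
near=> n; have nk : (k < n)%N by near: n; exists k.+1.
rewrite /series /= (bigD1_seq k) ?iota_uniq ?mem_index_iota //= eqxx expr1n big1.
  by rewrite addr0; exact: ballxx.
by move=> i /negPf ->; rewrite expr0n.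
Unshelve. all: by end_near. Qed.
Definition delta_seq k : H := Ell2 (delta_seq_subproof k).

Lemma dot_delta_seq k x : dot (delta_seq k) x = x k.
Proof.
rewrite /dot; apply: cvg_lim => //; apply/cvg_ballP => e e0.
near=> n; have nk : (k < n)%N by near: n; exists k.+1.
rewrite /series /= (bigD1_seq k) ?iota_uniq ?mem_index_iota //= eqxx mul1r big1.
  by rewrite addr0; exact: ballxx.
by move=> i /negPf ->; rewrite mul0r.
Unshelve. all: by end_near. Qed.

End Ell2Theory.

(** * Gradients and quadratic functions *)

Section Gradients.
Variable R : realType.
Local Notation H := (ell2 R).
Implicit Types (x y z v g b : H) (h : H -> R).

Lemma dot_is_linear g : linear (dot g : H -> R^o).
Proof. by move=> k x y; rewrite !dotE. Qed.

HB.instance Definition _ g := GRing.isLinear.Build R H R^o *:%R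
  (dot g : H -> R^o) (dot_is_linear g).

Lemma dot_continuous g : continuous (dot g : H -> R^o).
Proof.
apply: bounded_linear_continuous; apply/linear_boundedP.
near=> r => x; apply: le_trans (normr_dot_le _ _) _.
by rewrite ler_wpM2r //; near: r; exact: nbhs_pinfty_ge.
Unshelve. all: by end_near. Qed.

Lemma is_gradient_quadratic h x g (K : R) :
  (forall v, `|h (v + x) - h x - dot g v| <= K * `|v| ^+ 2) -> is_gradient h x g.
Proof.
move=> hK.
have e : (h : H -> R^o) \o shift x = cst (h x) + (dot g : H -> R^o) +o_ 0 id.
  apply/eqaddoP => e e0; near=> v.
  rewrite (_ : (_ - _) v = h (v + x) - h x - dot g v); last first.
    by rewrite !fctE /= opprD addrA.
  apply: le_trans (hK v) _; rewrite expr2 mulrA ler_wpM2r //.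
  (* Replacing [K] by [|K| + 1] gives a positive denominator for the radius, whatever the sign of
     [K]. *)
  apply: (@le_trans _ _ ((`|K| + 1) * `|v|)).
    by rewrite ler_wpM2r // (le_trans (ler_norm _)) // lerDl.
  rewrite mulrC -ler_pdivlMr ?ltr_wpDl //; apply: ltW; near: v.
  by apply/nbhs_norm0P; exists (e / (`|K| + 1)) => //=; rewrite divr_gt0 ?ltr_wpDl.
have d := diff_unique (@dot_continuous g) e.
split; last by move=> v; rewrite d.
by apply/diff_locallyP; rewrite d; split=> //; exact: dot_continuous.
Unshelve. all: by end_near. Qed.

(** Since [S] fixes [x] and preserves [h], the difference quotients at [x] along [v] and along [S v]
    coincide. *)
Lemma gradient_invariant h (S : H -> H) x z :
  (forall k u v, S (k *: u + v) = k *: S u + S v) -> S x = x ->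
  (forall y, h (S y) = h y) -> is_gradient h x z ->
  forall v, dot z (S v) = dot z v.
Proof.
move=> Slin Sx hS [dh zE] v; rewrite -!zE -!deriveE // /derive.
rewrite [X in X @ _](_ : _ =
  (fun k : R => k^-1 *: (((h : H -> R^o) \o shift x) (k *: v) - h x))) //.
apply/funext => k /=.
by rewrite -[in LHS]Sx -Slin !hS.
Qed.

(** For [n >= m] the reflection negates the basis vector [delta_seq R n], so coordinate [n] of the
    gradient equals its own opposite. *)
Lemma gradient_coords_below m h x z : (forall y, h (flip m y) = h y) ->
  coords_below m x -> is_gradient h x z -> coords_below m z.
Proof.
move=> hS xm hz n mn.
have := gradient_invariant (@flip_linear R m) (coords_below_flip xm) hS hz (delta_seq R n).
have -> : flip m (delta_seq R n) = - delta_seq R n.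
  apply: ell2_ext => k; rewrite flipE ell2NE; case: ltnP => // km.
  by rewrite /= (_ : (k == n) = false) ?oppr0 //; apply/eqP; lia.
rewrite dotNr dotC dot_delta_seq; lra.
Qed.

(** Reindex the supremum by the reflection, which preserves both [h] and the scalar product. *)
Lemma convex_conjugate_flip m h : (forall y, h (flip m y) = h y) ->
  forall y, convex_conjugate h (flip m y) = convex_conjugate h y.
Proof.
move=> hS y; rewrite /convex_conjugate; congr (ereal_sup _).
apply/seteqP; split => _ [u _ <-]; exists (flip m u) => //=; rewrite hS.
  by rewrite -(dot_flip m y) flipK.
by rewrite dot_flip.
Qed.

Lemma egradient_coords_below m h x z : (forall y, h (flip m y) = h y) ->
  coords_below m x -> is_egradient (convex_conjugate h) x z -> coords_below m z.
Proof.
move=> hS xm [_ hz]; apply: gradient_coords_below xm hz => y /=.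
by rewrite convex_conjugate_flip.
Qed.

Definition quadratic (T : H -> H) b x : R := dot (T x) x / 2 - dot b x.

Section Quadratic.
Variables (T : H -> H) (b : H).
Hypothesis T_linear : forall k x y, T (k *: x + y) = k *: T x + T y.
Hypothesis T_sym : forall x y, dot (T x) y = dot x (T y).

Let TD x y : T (x + y) = T x + T y.
Proof. by have := T_linear 1 x y; rewrite !scale1r. Qed.

Let TZ k x : T (k *: x) = k *: T x.
Proof.
have := T_linear (- 1) 0 0; rewrite scaler0 addr0 scaleN1r addNr => T0.
by have := T_linear k x 0; rewrite T0 !addr0.
Qed.

Let TN x : T (- x) = - T x.
Proof. by rewrite -scaleN1r TZ scaleN1r. Qed.

Lemma quadratic_expand x v : quadratic T b (v + x) =
  quadratic T b x + dot (T x - b) v + dot (T v) v / 2.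
Proof.
rewrite /quadratic TD !dotE (T_sym v x) (dotC v (T x)); lra.
Qed.

Lemma quadratic_gradient (K : R) : (forall x, `|T x| <= K * `|x|) ->
  forall x, is_gradient (quadratic T b) x (T x - b).
Proof.
move=> TK x; apply: (@is_gradient_quadratic _ _ _ (K / 2)) => v.
rewrite quadratic_expand (_ : _ - _ = dot (T v) v / 2); last by ring.
rewrite normrM [`|2^-1|]ger0_norm ?invr_ge0 // mulrAC ler_wpM2r ?invr_ge0 //.
apply: le_trans (normr_dot_le _ _) _.
by rewrite expr2 mulrA ler_wpM2r.
Qed.

Lemma quadratic_smooth (K : R) : (forall x, `|T x| <= K * `|x|) ->
  smooth K (quadratic T b).
Proof.
move=> TK; exists (fun x => T x - b); first exact: quadratic_gradient TK.
move=> x y; rewrite opprB addrA subrK -TN -TD; exact: TK.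
Qed.

Lemma quadratic_strongly_convex (K mu : R) : (forall x, `|T x| <= K * `|x|) ->
  (forall x, mu * `|x| ^+ 2 <= dot (T x) x) -> strongly_convex mu (quadratic T b).
Proof.
move=> TK Tmu; exists (fun x => T x - b); first exact: quadratic_gradient TK.
move=> x y; rewrite -[in leRHS](subrK x y) quadratic_expand lerD2l.
have := Tmu (y - x); lra.
Qed.

Lemma quadratic_convex : (forall x, 0 <= dot (T x) x) ->
  convex_function [set: H] (quadratic T b : H -> R^o).
Proof.
move=> T0 t x y _ _; rewrite /conv /=.
have := ge0 t; have := le1 t; set s := t%:num => s1 s0.
rewrite -[leRHS]/(s * quadratic T b x + (1 - s) * quadratic T b y) /unstable.onem -subr_ge0.
have -> : s * quadratic T b x + (1 - s) * quadratic T b y -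
    quadratic T b (s *: (x : H) + (1 - s) *: (y : H)) =
    s * (1 - s) / 2 * dot (T (x - y)) (x - y).
  rewrite /quadratic !(TD, TZ, TN) !dotE (T_sym y x) (dotC y (T x)).
  lra.
by rewrite mulr_ge0 ?divr_ge0 ?mulr_ge0 ?subr_ge0 ?s1 ?s0.
Qed.

Lemma quadratic_minimizer x : (forall v, 0 <= dot (T v) v) -> T x = b ->
  is_minimizer (quadratic T b) x.
Proof.
move=> T0 Tx y; rewrite -[in leRHS](subrK x y) quadratic_expand Tx subrr.
have := T0 (y - x); rewrite (_ : dot 0 _ = 0) //; first lra.
by rewrite -(scale0r 0) dotZl mul0r.
Qed.

End Quadratic.
End Gradients.

(** * The quadratic chain *)

Section Operators.
Variable R : realType.
Local Notation H := (ell2 R).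
Implicit Types (x y z v g b : H) (mu s : R).

(** The Laplacian of one matching plus a multiple of the identity. For [p = true] coordinate 0 is
    unpaired and contributes its own square, the Dirichlet end of the chain. *)
Definition local_op mu s (p : bool) x : H := mu *: x + s *: (x - swap p x).

Lemma local_op_linear mu s p k x y :
  local_op mu s p (k *: x + y) = k *: local_op mu s p x + local_op mu s p y.
Proof.
rewrite /local_op swap_linear; apply: ell2_ext => n; rewrite !ell2E; ring.
Qed.

Lemma local_op_sym mu s p x y : dot (local_op mu s p x) y = dot x (local_op mu s p y).
Proof. by rewrite /local_op !dotE swap_sym. Qed.

Lemma local_op_ge0 mu s p x : 0 <= mu -> 0 <= s -> 0 <= dot (local_op mu s p x) x.
Proof.
move=> mu0 s0; rewrite /local_op !dotE addr_ge0 ?mulr_ge0 ?dot_ge0 //.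
by rewrite subr_ge0 swap_le.
Qed.

Lemma local_op_norm mu s p x : 0 <= mu -> 0 <= s ->
  `|local_op mu s p x| <= (mu + s * 3) * `|x|.
Proof.
move=> mu0 s0; apply: le_trans (ler_normD _ _) _.
rewrite !normrZ !ger0_norm // mulrDl lerD2l -mulrA ler_wpM2l //.
by apply: le_trans (ler_normB _ _) _; have := swap_norm p x; lra.
Qed.

Definition local_fun mu s p b := quadratic (local_op mu s p) b.

Lemma local_fun_convex mu s p b : 0 <= mu -> 0 <= s ->
  convex_function [set: H] (local_fun mu s p b : H -> R^o).
Proof.
move=> mu0 s0; apply: quadratic_convex => *; [exact: local_op_linear|exact: local_op_sym|].
exact: local_op_ge0.
Qed.

Lemma local_fun_smooth mu s p b : 0 <= mu -> 0 <= s ->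
  smooth (mu + s * 3) (local_fun mu s p b).
Proof.
move=> mu0 s0; apply: quadratic_smooth => *; [exact: local_op_linear|exact: local_op_sym|].
exact: local_op_norm.
Qed.

(** The case [s = 0] serves the nodes holding only the regularizer; otherwise the parity of [m]
    keeps the matching from crossing the boundary. *)
Lemma local_fun_flip mu s p b m : s = 0 \/ odd m = p -> flip m b = b ->
  forall x, local_fun mu s p b (flip m x) = local_fun mu s p b x.
Proof.
move=> sp bm x; rewrite /local_fun /quadratic -[in dot b _]bm dot_flip.
congr (_ / 2 - _); rewrite /local_op !dotE dot_flip.
by case: sp => [->|mp]; rewrite ?mul0r // swap_flip // dot_flip.
Qed.

(** Nesterov's operator: the second difference on the half line with zero boundary value, plus [mu]
    times the identity. *)
Definition chain_op mu s x : H := mu *: x + s *: (x + x - shiftl x - shiftr x).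

Lemma chain_opE mu s x n : chain_op mu s x n = mu * x n +
  s * (x n + x n - x n.+1 - (if n is k.+1 then x k else 0)).
Proof. by []. Qed.

Lemma chain_op_linear mu s k x y :
  chain_op mu s (k *: x + y) = k *: chain_op mu s x + chain_op mu s y.
Proof.
apply: ell2_ext => n; rewrite !(chain_opE, ell2E).
by case: n => [|n]; rewrite ?ell2E; ring.
Qed.

Lemma chain_op_sym mu s x y : dot (chain_op mu s x) y = dot x (chain_op mu s y).
Proof.
rewrite /chain_op !dotE dot_shift (dotC (shiftr x) y) -(dot_shift y x) (dotC (shiftl y)).
ring.
Qed.

Lemma chain_op_ge mu s x : 0 <= s -> mu * `|x| ^+ 2 <= dot (chain_op mu s x) x.
Proof.
move=> s0; rewrite ell2_norm_sqr /chain_op !dotE lerDl mulr_ge0 //.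
rewrite dot_shift [dot (shiftr x) x]dotC.
by have := dot_mul_le x (shiftr x); rewrite dot_shiftr; lra.
Qed.

Lemma chain_op_norm mu s x : 0 <= mu -> 0 <= s ->
  `|chain_op mu s x| <= (mu + 4 * s) * `|x|.
Proof.
move=> mu0 s0; apply: le_trans (ler_normD _ _) _.
rewrite !normrZ !ger0_norm // mulrDl lerD2l [4 * s]mulrC -mulrA ler_wpM2l //.
apply: le_trans (ler_normB _ _) _.
have := ler_normB (x + x) (shiftl x); have := ler_normD x x.
have := ler_ell2_norm (dot_shiftl_le x).
have : `|shiftr x| <= `|x| by apply: ler_ell2_norm; rewrite dot_shiftr.
lra.
Qed.

(* The off-diagonal part of the chain Laplacian splits into two matchings. *)
Lemma swapD x : swap true x + swap false x = shiftl x + shiftr x.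
Proof.
apply: ell2_ext => n; rewrite !ell2DE !swapE /=.
by case: (odd n) => //=; rewrite addrC.
Qed.

Lemma chain_op_split mu s x : dot (chain_op mu s x) x =
  mu * dot x x + s * (dot (x - swap true x) x + dot (x - swap false x) x).
Proof.
rewrite -dotDl addrACA -opprD swapD opprD !addrA /chain_op !dotE.
by ring.
Qed.

Lemma geometric_subproof (q : R) : 0 <= q -> q < 1 ->
  (fun n => q ^+ n.+1) \in @square_summable R.
Proof.
move=> q0 q1; apply/square_summableP.
rewrite (_ : (fun n => _) = geometric (q ^+ 2) (q ^+ 2)).
  apply: is_cvg_geometric_series.
  by rewrite ger0_norm ?exprn_ge0 // expr_lt1.
by apply/funext => n; rewrite /geometric /= -exprS -!exprM mulnC.
Qed.

(** The hypothesis is the characteristic equation of the three-term recurrence. The sequence would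
    continue with value 1 at index -1, where the chain has 0; this leaves the defect [s] at
    coordinate 0. *)
Lemma chain_op_geometric (q mu s : R) (q0 : 0 <= q) (q1 : q < 1) :
  mu * q = s * (1 - q) ^+ 2 ->
  chain_op mu s (Ell2 (geometric_subproof q0 q1)) = s *: delta_seq R 0.
Proof.
move=> e; apply: ell2_ext => -[|n]; rewrite !ell2E /=.
  by rewrite ?eqxx !expr1 e; ring.
rewrite mulr0 (_ : _ + _ = q ^+ n.+1 * (mu * q - s * (1 - q) ^+ 2)).
  by rewrite e subrr mulr0.
by rewrite !exprS; ring.
Qed.

(** Coordinate [m] alone, the first one missing from [x], already gives this error. *)
Lemma geometric_dist (q : R) (q0 : 0 <= q) (q1 : q < 1) m x : coords_below m x ->
  q ^+ (2 * m.+1) <= `|x - Ell2 (geometric_subproof q0 q1)| ^+ 2.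
Proof.
move=> xm; rewrite ell2_norm_sqr; apply: le_trans (dot_ge_term _ m).
by rewrite !ell2E (xm m (leqnn m)) add0r sqrrN -exprM mulnC.
Qed.

Definition rate (k : R) : R := (Num.sqrt k - 1) / (Num.sqrt k + 1).

Lemma rate_bounds (k : R) : 10 < k -> 0 < rate k < 1.
Proof.
move=> k10; have k1 : 1 < Num.sqrt k by rewrite -sqrtr1 ltr_sqrt; lra.
rewrite /rate divr_gt0 /= ?subr_gt0 ?addr_gt0 //; try lra.
by rewrite ltr_pdivrMr; lra.
Qed.

(** The characteristic equation of the chain for [s = (L - mu) / 4] and [k = L / mu], divided by
    [mu / 4]. *)
Lemma rate_eq (k : R) : 10 < k -> 4 * rate k = (k - 1) * (1 - rate k) ^+ 2.
Proof.
move=> k10; have k1 : 1 < Num.sqrt k by rewrite -sqrtr1 ltr_sqrt; lra.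
have e : k = Num.sqrt k ^+ 2 by rewrite sqr_sqrtr; lra.
move: e k1; rewrite /rate; move: (Num.sqrt k) => r -> r1; field; lra.
Qed.

Lemma rate_dist (k eps : R) m : 10 < k -> 0 < eps ->
  rate k ^+ (2 * m.+1) <= eps -> Num.sqrt k * ln (1 / eps) <= 8 * m.+1%:R.
Proof.
move=> k10 eps0 le_eps; have /andP[q0 q1] := rate_bounds k10.
(* This bound turns [2 / (Num.sqrt k - 1)] into at most [4 / Num.sqrt k] below. *)
have k2 : 2 < Num.sqrt k.
  by rewrite (_ : 2 = Num.sqrt (2 ^+ 2)) ?ltr_sqrt ?sqrtr_sqr ?ger0_norm //; lra.
have lnq : - ln (rate k) <= 4 / Num.sqrt k.
  rewrite -lnV ?posrE //.
  have -> : (rate k)^-1 = 1 + 2 / (Num.sqrt k - 1) by rewrite /rate; field; lra.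
  apply: le_trans (le_ln1Dx _) _; first by rewrite (lt_le_trans (ltrN10 _)) // divr_ge0; lra.
  rewrite ler_pdivrMr; last by lra.
  rewrite mulrAC ler_pdivlMr; lra.
have : ln (1 / eps) <= (2 * m.+1)%:R * - ln (rate k).
  rewrite div1r lnV ?posrE // mulrN lerN2 mulr_natl -lnXn // ler_ln ?posrE //.
  by rewrite exprn_gt0.
move=> /le_trans/(_ (ler_wpM2l _ lnq)) => /(_ (ler0n _ _)) h.
have := ler_wpM2l (sqrtr_ge0 k) h.
rewrite [leRHS](_ : _ = 8 * m.+1%:R) //.
by rewrite natrM; field; lra.
Qed.

End Operators.

(** * Rayleigh quotients *)

Section Rayleigh.
Variables (R : realType) (n : nat).
Implicit Types (A M : 'M[R]_n) (x y : 'rV[R]_n).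

Definition bilin A x y : R := (x *m A *m y^T) 0 0.
Definition sqn x : R := \sum_j x 0 j ^+ 2.

Lemma bilinE A x y : bilin A x y = \sum_j (\sum_i x 0 i * A i j) * y 0 j.
Proof. by rewrite /bilin mxE; apply: eq_bigr => j _; rewrite !mxE. Qed.

Lemma sqnE x : sqn x = (x *m x^T) 0 0.
Proof. by rewrite mxE; apply: eq_bigr => j _; rewrite !mxE expr2. Qed.

Lemma sqn_ge0 x : 0 <= sqn x.
Proof. by apply: sumr_ge0 => j _; exact: sqr_ge0. Qed.

Lemma sqn_gt0 x : x != 0 -> 0 < sqn x.
Proof.
move=> x0; rewrite lt_neqAle sqn_ge0 andbT eq_sym; apply: contra x0 => /eqP s0.
apply/eqP/rowP => j; rewrite mxE; apply/eqP; rewrite -sqrf_eq0; apply/eqP.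
by apply: (psumr_eq0P _ s0) => // i _; exact: sqr_ge0.
Qed.

Lemma bilinDl A x x' y : bilin A (x + x') y = bilin A x y + bilin A x' y.
Proof. by rewrite /bilin !mulmxDl mxE. Qed.
Lemma bilinDr A x y y' : bilin A x (y + y') = bilin A x y + bilin A x y'.
Proof. by rewrite /bilin linearD /= mulmxDr mxE. Qed.
Lemma bilinZl A k x y : bilin A (k *: x) y = k * bilin A x y.
Proof. by rewrite /bilin -!scalemxAl mxE. Qed.
Lemma bilinZr A k x y : bilin A x (k *: y) = k * bilin A x y.
Proof. by rewrite /bilin linearZ /= -scalemxAr mxE. Qed.

Lemma bilin_sym A x y : A^T = A -> bilin A x y = bilin A y x.
Proof.
by move=> As; rewrite /bilin -[x *m A *m y^T]trmxK mxE !trmx_mul trmxK As mulmxA.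
Qed.

Lemma bilin_CauchySchwarz M x y : M^T = M -> (forall z, 0 <= bilin M z z) ->
  bilin M x y ^+ 2 <= bilin M x x * bilin M y y.
Proof.
move=> Ms M0; have yx := bilin_sym y x Ms.
have q k : 0 <= bilin M x x + 2 * k * bilin M x y + k ^+ 2 * bilin M y y.
  by have := M0 (x + k *: y); rewrite !(bilinDl, bilinDr, bilinZl, bilinZr) yx; lra.
have [yy0|yy0] := eqVneq (bilin M y y) 0.
  rewrite yy0 mulr0; have [->|xy0] := eqVneq (bilin M x y) 0; first by rewrite expr0n.
  (* Here the nonnegative quadratic in [k] is affine; at this [k] it would equal -1. *)
  have := q (- (bilin M x x + 1) / (2 * bilin M x y)).
  rewrite yy0 mulr0 addr0 (_ : 2 * _ * _ = - (bilin M x x + 1)); first lra.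
  by field.
have yyp : 0 < bilin M y y by rewrite lt_neqAle eq_sym yy0 M0.
have := q (- bilin M x y / bilin M y y).
have -> : bilin M x x + 2 * (- bilin M x y / bilin M y y) * bilin M x y +
  (- bilin M x y / bilin M y y) ^+ 2 * bilin M y y =
  (bilin M x x * bilin M y y - bilin M x y ^+ 2) / bilin M y y by field.
by rewrite pmulr_lge0 ?invr_gt0 // subr_ge0.
Qed.

Lemma bilin_bound A : exists2 C, 0 < C & forall x, `|bilin A x x| <= C * sqn x.
Proof.
have s0 : 0 <= \sum_j \sum_i `|A i j| by do 2![apply: sumr_ge0 => ? _].
(* The summand 1 makes the constant positive even for [A = 0], so that it can be inverted later. *)
exists (1 + \sum_j \sum_i `|A i j|) => [|x]; first lra.
apply: (@le_trans _ _ ((\sum_j \sum_i `|A i j|) * sqn x)); last first.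
  by have := sqn_ge0 x; lra.
have xle i : `|x 0 i| ^+ 2 <= sqn x.
  rewrite real_normK ?num_real // /sqn (bigD1 i) //= lerDl.
  by apply: sumr_ge0 => j _; exact: sqr_ge0.
rewrite bilinE mulr_suml; apply: le_trans (ler_norm_sum _ _ _) _.
apply: ler_sum => j _; rewrite mulr_suml mulr_suml.
apply: le_trans (ler_norm_sum _ _ _) _; apply: ler_sum => i _.
rewrite !normrM mulrAC mulrC ler_wpM2l //.
have := sqr_ge0 (`|x 0 i| - `|x 0 j|); have := xle i; have := xle j; lra.
Qed.

(* The infimum of the Rayleigh quotient is an eigenvalue: otherwise [A] minus
   that infimum would be positive semidefinite and invertible, hence bounded
   below by the Cauchy-Schwarz inequality, contradicting minimality. *)
Lemma rayleigh_eigenvalue A x : A^T = A -> x != 0 ->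
  exists2 a, eigenvalue A a & a * sqn x <= bilin A x x.
Proof.
move=> As x0.
pose S := [set r | exists2 y, y != 0 & r = bilin A y y / sqn y].
have [C C0 AC] := bilin_bound A.
have lbS : lbound S (- C).
  move=> _ [y y0 ->]; rewrite ler_pdivlMr ?sqn_gt0 //.
  by have := AC y; rewrite ler_norml mulNr => /andP[].
have infS : has_inf S by split; [exists (bilin A x x / sqn x), x|exists (- C)].
pose a := inf S; exists a; last first.
  rewrite -ler_pdivlMr ?sqn_gt0 //; apply: (ge_inf infS.2); by exists x.
pose M := A - a%:M.
have bM y z : bilin M y z = bilin A y z - a * (y *m z^T) 0 0.
  by rewrite /bilin /M mulmxBr mulmxBl mul_mx_scalar -scalemxAl !mxE.
have Ms : M^T = M by rewrite /M linearB /= As tr_scalar_mx.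
have M0 y : 0 <= bilin M y y.
  have [->|y0] := eqVneq y 0; first by rewrite /bilin !mul0mx mxE.
  rewrite bM -sqnE subr_ge0 -ler_pdivlMr ?sqn_gt0 //.
  by apply: (ge_inf infS.2); exists y.
have [Mu|Mu] := boolP (M \in unitmx); last first.
  by rewrite /eigenvalue /eigenspace kermx_eq0 row_free_unit.
have [K K0 MK] := bilin_bound (invmx M).
have Mlow y : K^-1 * sqn y <= bilin M y y.
  have [->|y0] := eqVneq y 0.
    by rewrite /bilin !mul0mx mxE /sqn big1 ?mulr0 // => j _; rewrite mxE expr0n.
  (* With this second vector the mixed term is [sqn y], so the upper bound [K] for the inverse
     becomes the lower bound [K^-1] for [M]. *)
  have := bilin_CauchySchwarz y (y *m invmx M) Ms M0.
  have -> : bilin M y (y *m invmx M) = sqn y.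
    by rewrite /bilin trmx_mul trmx_inv Ms mulmxA mulmxK // sqnE.
  have -> : bilin M (y *m invmx M) (y *m invmx M) = bilin (invmx M) y y.
    by rewrite /bilin mulmxKV // trmx_mul trmx_inv Ms !mulmxA.
  have := MK y; rewrite ler_norml => /andP[_ up].
  move=> /le_trans/(_ (ler_wpM2l (M0 y) up)) h.
  rewrite mulrC ler_pdivrMr // -(ler_pM2r (sqn_gt0 y0)) -mulrA -expr2 //.
have : a + K^-1 <= a; last by rewrite gerDl leNgt invr_gt0 K0.
apply: lb_le_inf; first exact: infS.1.
move=> _ [y y0 ->]; rewrite ler_pdivlMr ?sqn_gt0 //.
by have := Mlow y; rewrite bM -sqnE; lra.
Qed.

End Rayleigh.

(** * Two heaps joined by a bridge *)

Section TwoHeaps.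
Local Open Scope nat_scope.

(* [{0..b}] carries a binary heap rooted at [0], [{b+1..N}] the mirror image of
   a binary heap, rooted at [N]; the bridge [{b, b+1}] joins a leaf of the first
   to a leaf of the second. *)
Definition heap_edge (N b i j : nat) : bool :=
  [|| (0 < j <= b) && (i == j.-1./2),
      (b < j < N) && (i == N - (N - j).-1./2)
    | (j == b) && (i == b.+1)].

Lemma heap_edge_left N b k : 0 < k <= b -> heap_edge N b k.-1./2 k.
Proof. by rewrite /heap_edge => ->; rewrite eqxx. Qed.

Lemma heap_edge_right N b k : 0 < k < N - b -> heap_edge N b (N - k.-1./2) (N - k).
Proof.
move=> h; rewrite /heap_edge (_ : N - (N - k) = k); last by lia.
by rewrite eqxx (_ : b < N - k < N) ?orbT //; lia.
Qed.

Lemma heap_edge_bridge N b : heap_edge N b b.+1 b.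
Proof. by rewrite /heap_edge !eqxx !orbT. Qed.

Lemma heap_edge_neq N b i j : heap_edge N b i j -> i != j.
Proof. by rewrite /heap_edge; lia. Qed.

(** This serves twice: news can cross only by the bridge, and the cut vector has energy only
    there. *)
Lemma heap_edge_side N b i j : heap_edge N b i j || heap_edge N b j i ->
  [\/ (i <= b) = (j <= b), i = b /\ j = b.+1 | i = b.+1 /\ j = b].
Proof.
rewrite /heap_edge => h; case: (leqP i b) => ib; case: (leqP j b) => jb.
- by constructor 1.
- by constructor 2; lia.
- by constructor 3; lia.
- by constructor 1.
Qed.

Definition two_heaps (N b : nat) : {set {set 'I_N.+1}} :=
  [set e | [exists i : 'I_N.+1, exists j : 'I_N.+1,
    (e == [set i; j]%SET) && heap_edge N b i j]]%SET.

Lemma set2_eq (T : finType) (i j k l : T) : [set i; j]%SET = [set k; l]%SET ->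
  i = k /\ j = l \/ i = l /\ j = k.
Proof.
move=> e; have : i \in [set k; l]%SET by rewrite -e set21.
have : j \in [set k; l]%SET by rewrite -e set22.
have : k \in [set i; j]%SET by rewrite e set21.
have : l \in [set i; j]%SET by rewrite e set22.
rewrite !inE => /orP[]/eqP h1 /orP[]/eqP h2 /orP[]/eqP h3 /orP[]/eqP h4; subst; by auto.
Qed.

Lemma two_heapsP N b (e : {set 'I_N.+1}) :
  reflect (exists i j : 'I_N.+1, e = [set i; j]%SET /\ heap_edge N b i j)
    (e \in two_heaps N b).
Proof.
rewrite inE; apply: (iffP existsP) => [[i /existsP[j /andP[/eqP ? ?]]]|[i [j [-> ?]]]].
  by exists i, j.
by exists i; apply/existsP; exists j; rewrite eqxx.
Qed.

Lemma adjacent_two_heaps N b (i j : 'I_N.+1) :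
  Defs.adjacent (two_heaps N b) i j = heap_edge N b i j || heap_edge N b j i.
Proof.
rewrite /Defs.adjacent; apply/two_heapsP/idP => [[k [l [/set2_eq[][-> ->] ->]]]|/orP[] h];
  rewrite ?orbT //.
  by exists i, j.
by exists j, i; rewrite finset.setUC.
Qed.

Lemma two_heaps_simple N b : simple_graph (two_heaps N b).
Proof. by move=> e /two_heapsP[i [j [-> /heap_edge_neq ij]]]; rewrite cards2 ij. Qed.

Lemma adjacent_sym N b : symmetric (Defs.adjacent (two_heaps N b)).
Proof. by move=> i j; rewrite !adjacent_two_heaps orbC. Qed.

(** Parents have smaller indices in the left heap and larger ones in the right heap, so induction
    reaches the two roots, and the bridge links the heaps. *)
Lemma two_heaps_connected N b : b < N -> connected_graph (two_heaps N b).
Proof.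
move=> bN; have csym : connect_sym (Defs.adjacent (two_heaps N b)).
  by apply: sym_connect_sym; exact: adjacent_sym.
have left (i : 'I_N.+1) : i <= b -> connect (Defs.adjacent (two_heaps N b)) ord0 i.
  have [k] := ubnP (i : nat); elim: k i => // k IH i ik ib.
  have [i0|i0] := posnP i; first by rewrite (_ : i = ord0) //; apply/val_inj.
  have pN : i.-1./2 < N.+1 by lia.
  apply: (@connect_trans _ _ (Ordinal pN)); first by apply: IH => /=; lia.
  by apply: connect1; rewrite adjacent_two_heaps /heap_edge /= i0 ib eqxx.
have right (i : 'I_N.+1) : b < i -> connect (Defs.adjacent (two_heaps N b)) ord_max i.
  have [k] := ubnP (N - i); elim: k i => // k IH i ik ib.
  have iN := ltn_ord i.
  have [i0|i0] := posnP (N - i).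
    by rewrite (_ : i = ord_max) //; apply/val_inj => /=; lia.
  have pN : N - (N - i).-1./2 < N.+1 by lia.
  apply: (@connect_trans _ _ (Ordinal pN)); first by apply: IH => /=; lia.
  apply: connect1; rewrite adjacent_two_heaps /heap_edge /= eqxx andbT ib /=.
  by rewrite (_ : i < N) ?orbT //; lia.
have bl : b < N.+1 by lia. have br : b.+1 < N.+1 by lia.
have mid : connect (Defs.adjacent (two_heaps N b)) ord0 ord_max.
  apply: connect_trans (left (Ordinal bl) _) _ => //.
  rewrite csym; apply: connect_trans (right (Ordinal br) _) _ => //=.
  by apply: connect1; rewrite adjacent_two_heaps /heap_edge /= !eqxx !orbT.
have all0 i : connect (Defs.adjacent (two_heaps N b)) ord0 i.
  have [ib|ib] := leqP i b; first exact: left.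
  exact: connect_trans mid (right _ ib).
by move=> i j; apply: connect_trans (all0 j); rewrite csym.
Qed.

Lemma card_set_le (T : finType) (A : {set T}) (s : seq T) :
  {subset A <= s} -> #|A| <= size s.
Proof.
move=> As; apply: leq_trans (card_size s); apply: subset_leq_card.
by apply/fintype.subsetP => x /As.
Qed.

(** The candidates are a parent and two children in each heap, and the two possible bridge
    partners. *)
Lemma two_heaps_degree N b (i : 'I_N.+1) :
  #|[set j | Defs.adjacent (two_heaps N b) i j]%SET| <= 8.
Proof.
apply: (@card_set_le _ _ [seq inord k | k <- [:: i.-1./2; i.*2.+1; i.*2.+2;
  N - (N - i).-1./2; N - (N - i).*2.+1; N - (N - i).*2.+2; i.+1; i.-1]]) => j.
rewrite inE adjacent_two_heaps => h; rewrite -(inord_val j); apply: map_f.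
rewrite !inE; move: h (ltn_ord i) (ltn_ord j); move: (i : nat) (j : nat) => {}i {}j.
move=> /orP[]/or3P[]/andP[h1 /eqP h2] iN jN.
- have /orP[/eqP ->|/eqP ->] : (j == i.*2.+1) || (j == i.*2.+2) by lia.
    by rewrite eqxx !orbT.
  by rewrite eqxx !orbT.
- have /orP[/eqP ->|/eqP ->] : (j == N - (N - i).*2.+1) || (j == N - (N - i).*2.+2) by lia.
    by rewrite eqxx !orbT.
  by rewrite eqxx !orbT.
- have -> : j = i.-1 by lia.
  by rewrite eqxx !orbT.
- by rewrite h2 eqxx.
- by rewrite h2 eqxx !orbT.
- by rewrite (eqP h1) h2 eqxx !orbT.
Qed.

(** Only vertex [b.+1] changes heap, and it is a leaf in both. The list holds the old bridge, its
    new and its old parent edge, and the new bridge. *)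
Lemma two_heaps_changes N b :
  #|((two_heaps N b :\: two_heaps N b.+1) :|:
     (two_heaps N b.+1 :\: two_heaps N b))%SET| <= 4.
Proof.
pose pr k l : {set 'I_N.+1} := [set inord k; inord l]%SET.
apply: (@card_set_le _ _ [:: pr b.+1 b; pr b./2 b.+1;
  pr (N - (N - b.+1).-1./2) b.+1; pr b.+2 b.+1]) => e.
have prE (i j : 'I_N.+1) k l : i = k :> nat -> j = l :> nat -> [set i; j]%SET = pr k l.
  by move=> <- <-; rewrite /pr !inord_val.
have diff b1 b2 : e \in (two_heaps N b1 :\: two_heaps N b2)%SET ->
    exists i j : 'I_N.+1, [/\ e = [set i; j]%SET, heap_edge N b1 i j & ~~ heap_edge N b2 i j].
  rewrite finset.in_setD => /andP[ne /two_heapsP[i [j [eij aij]]]]; exists i, j.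
  by split=> //; apply: contra ne => h; apply/two_heapsP; exists i, j.
rewrite finset.in_setU => /orP[] /diff [i [j [-> /or3P[] /andP[h1 /eqP h2]]]]; rewrite !inE.
- by rewrite /heap_edge; lia.
- have [jb|jb] := eqVneq (j : nat) b.+1; last by rewrite /heap_edge; lia.
  by rewrite (prE _ _ _ _ h2 erefl) jb eqxx !orbT.
- by move=> _; rewrite (prE _ _ _ _ h2 (eqP h1)) eqxx.
- have [jb|jb] := eqVneq (j : nat) b.+1; last by rewrite /heap_edge; lia.
  by rewrite (prE _ _ _ _ h2 erefl) jb /= eqxx !orbT.
- by rewrite /heap_edge; lia.
- by move=> _; rewrite (prE _ _ _ _ h2 (eqP h1)) eqxx !orbT.
Qed.

End TwoHeaps.

(** * The sweeping schedule and the propagation of news *)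

Section Schedule.
Local Open Scope nat_scope.

(* The bridge sweeps from [0] to [N-1] and back again. *)
Definition bridge (N q : nat) : nat :=
  if odd (q %/ N) then N.-1 - q %% N else q %% N.

(* Bounds the leading block of nonzero coordinates known to node [i] after [q]
   communication rounds. *)
Definition level (N q i : nat) : nat :=
  q %/ N + (if odd (q %/ N) then N - q %% N <= i else i <= q %% N).

Lemma divmodS N q : 0 < N ->
  (q.+1 %/ N = q %/ N /\ q.+1 %% N = (q %% N).+1 /\ (q %% N).+1 < N) \/
  (q.+1 %/ N = (q %/ N).+1 /\ q.+1 %% N = 0 /\ (q %% N).+1 = N).
Proof.
move=> N0; have rN := ltn_pmod q N0.
have e : q.+1 = q %/ N * N + (q %% N).+1 by rewrite addnS -divn_eq.
have [h|h] := ltnP (q %% N).+1 N.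
  by left; rewrite e divnMDl // modnMDl (divn_small h) (modn_small h) addn0.
right; have rE : (q %% N).+1 = N by lia.
by rewrite e rE divnMDl // modnMDl divnn modnn N0 addn1.
Qed.

Lemma bridge_lt N q : 0 < N -> bridge N q < N.
Proof. by move=> N0; have := ltn_pmod q N0; rewrite /bridge; case: odd; lia. Qed.

(** The first case occurs at a turning point, where the bridge rests for one round. *)
Lemma bridgeS N q : 0 < N -> [\/ bridge N q.+1 = bridge N q,
  bridge N q.+1 = (bridge N q).+1 | bridge N q = (bridge N q.+1).+1].
Proof.
move=> N0; rewrite /bridge; case: (divmodS q N0) => -[-> [-> h]] /=.
  by case: (odd _); [constructor 3|constructor 2]; lia.
by case: (odd _) => /=; constructor 1; lia.
Qed.

(** Within a sweep the vertices of higher level are exactly the segment behind the bridge, so news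
    gains only the vertex at its far end, which [level] admits at [q.+1]. When a sweep ends, every
    level is already at least [(q %/ N).+1]. *)
Lemma level_adjacent N q i j : 0 < N -> i <= N ->
  j = i \/ heap_edge N (bridge N q) i j || heap_edge N (bridge N q) j i ->
  level N q j <= level N q.+1 i.
Proof.
move=> N0 iN adj.
have {adj} : (i <= bridge N q) = (j <= bridge N q)
   \/ i = bridge N q /\ j = (bridge N q).+1
   \/ i = (bridge N q).+1 /\ j = bridge N q.
  by case: adj => [->|/heap_edge_side[]]; auto.
rewrite /level /bridge; have rN := ltn_pmod q N0.
case: (divmodS q N0) => -[-> [-> h]] /=; case: ifP => op /= adj; lia.
Qed.

(** This parity and that of [level_last] say that neither end vertex holds the matching crossing its
    own boundary. *)
Lemma level_first N q : 0 < N -> odd (level N q 0).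
Proof.
move=> N0; have rN := ltn_pmod q N0; rewrite /level; case: ifP => op.
  by rewrite (_ : (_ <= 0) = false) ?addn0 //; lia.
by rewrite leq0n addn1 /= op.
Qed.

Lemma level_last N q : 0 < N -> ~~ odd (level N q N).
Proof.
move=> N0; have rN := ltn_pmod q N0; rewrite /level; case: ifP => op.
  by rewrite leq_subr addn1 /= op.
by rewrite leqNgt rN addn0 op.
Qed.

Lemma level_le N q i : level N q i <= (q %/ N).+1.
Proof. by rewrite /level; lia. Qed.

End Schedule.

(** * Laplacian eigenvalues *)

Section Laplacian.
Variables (R : realType) (n : nat) (E : {set {set 'I_n}}).
Local Notation adj := (@Defs.adjacent n E).
Hypothesis adj_sym : symmetric adj.
Local Notation L := (@laplacian n R E).
Implicit Types x : 'rV[R]_n.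

(** The sum is over ordered pairs, so every edge counts twice. *)
Definition energy x : R := \sum_i \sum_j (adj i j)%:R * (x 0 i - x 0 j) ^+ 2.

Lemma laplacianE i j : L i j = (i == j)%:R * (\sum_k (adj i k)%:R) - (adj i j)%:R.
Proof.
rewrite !mxE -sum1_card natr_sum; congr (_ - _).
rewrite big_mkcond /= mulrC mulr_natr; congr (_ *+ _).
by apply: eq_bigr => k _; rewrite inE; case: (adj i k).
Qed.

Lemma laplacian_sym : L^T = L.
Proof.
apply/matrixP => i j; rewrite mxE !laplacianE adj_sym; congr (_ - _).
by rewrite eq_sym; case: eqP => [->|]; rewrite ?mul0r.
Qed.

Lemma laplacian_row i : \sum_j L i j = 0.
Proof.
under eq_bigr => j _ do rewrite laplacianE.
rewrite sumrB -mulr_suml (_ : \sum_j (i == j)%:R = 1) ?mul1r ?subrr //.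
by rewrite (bigD1 i) //= eqxx big1 ?addr0 // => j ji; rewrite eq_sym (negPf ji).
Qed.

Lemma energyE x : energy x = 2 * bilin L x x.
Proof.
pose D := \sum_i \sum_j (adj i j)%:R * x 0 i ^+ 2.
pose C := \sum_i \sum_j (adj i j)%:R * (x 0 i * x 0 j).
have -> : energy x = D + D - 2 * C.
  rewrite {2}/D exchange_big /= /D /C mulr_sumr -big_split /= -sumrB.
  apply: eq_bigr => i _; rewrite mulr_sumr -big_split /= -sumrB.
  by apply: eq_bigr => j _; rewrite (adj_sym j i); ring.
have -> : bilin L x x = D - C; last by ring.
rewrite bilinE /D /C -sumrB; apply: eq_bigr => j _.
rewrite -sumrB mulr_suml (eq_bigr (fun i =>
  (i == j)%:R * ((\sum_k (adj j k)%:R) * x 0 j ^+ 2) - (adj j i)%:R * (x 0 j * x 0 i)))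
  => [|i _]; last first.
  rewrite laplacianE adj_sym; case: eqP => [->|_] /=; ring.
rewrite !sumrB; congr (_ - _); rewrite -mulr_suml -[RHS]mulr_suml.
by rewrite (bigD1 j) //= eqxx big1 ?addr0 ?mul1r // => i /negPf ->.
Qed.

Lemma energy_ge0 x : 0 <= energy x.
Proof. by do 2![apply: sumr_ge0 => ? _]; rewrite mulr_ge0 ?sqr_ge0. Qed.

Lemma energy_le d x : (forall i, (#|[set j | adj i j]%SET| <= d)%N) ->
  energy x <= 4 * d%:R * sqn x.
Proof.
move=> deg.
pose D := \sum_i \sum_j (adj i j)%:R * x 0 i ^+ 2.
have De : D <= d%:R * sqn x.
  rewrite /D /sqn mulr_sumr; apply: ler_sum => i _; rewrite -mulr_suml.
  rewrite ler_wpM2r ?sqr_ge0 //; apply: (@le_trans _ _ (#|[set j | adj i j]%SET|%:R)).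
    rewrite -sum1_card natr_sum [leRHS]big_mkcond /=; apply: ler_sum => k _.
    by rewrite inE; case: (adj i k).
  by rewrite ler_nat.
have : energy x <= 2 * (D + D); last lra.
rewrite {2}/D exchange_big /= /D -big_split /= mulr_sumr; apply: ler_sum => i _.
rewrite -big_split /= mulr_sumr; apply: ler_sum => j _.
rewrite (adj_sym j i) -mulrDr [leRHS]mulrCA ler_wpM2l //.
have := sqr_ge0 (x 0 i + x 0 j); lra.
Qed.

(** Eigenvectors for nonzero eigenvalues are thus orthogonal to the constants, where a Poincare
    inequality applies. *)
Lemma sum_mul_laplacian x a : x *m L = a *: x -> a * (\sum_j x 0 j) = 0.
Proof.
move=> xL; have e j : (x *m L) 0 j = a * x 0 j by rewrite xL mxE.
rewrite mulr_sumr -(eq_bigr _ (fun j _ => e j)).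
under eq_bigr => j _ do rewrite mxE.
rewrite exchange_big /= big1 // => i _.
by rewrite -mulr_sumr laplacian_row mulr0.
Qed.

Lemma bilin_eigen x a : x *m L = a *: x -> bilin L x x = a * sqn x.
Proof. by move=> xL; rewrite /bilin xL -scalemxAl mxE -sqnE. Qed.

Lemma eigenvalue_laplacian_le d a : (forall i, (#|[set j | adj i j]%SET| <= d)%N) ->
  eigenvalue L a -> a <= 2 * d%:R.
Proof.
move=> deg /eigenvalueP[v vL v0]; have := energy_le v deg.
rewrite energyE (bilin_eigen vL) => h; rewrite -(ler_pM2r (sqn_gt0 v0)); lra.
Qed.

Lemma eigenvalue_laplacian_ge K a :
  (forall x, \sum_j x 0 j = 0 -> sqn x <= K * energy x) ->
  0 < K -> eigenvalue L a -> a != 0 -> (2 * K)^-1 <= a.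
Proof.
move=> PK K0 /eigenvalueP[v vL v0] a0.
have s0 : \sum_j v 0 j = 0.
  by move/eqP: (sum_mul_laplacian vL); rewrite mulf_eq0 (negPf a0) /= => /eqP.
have := PK _ s0; rewrite energyE (bilin_eigen vL) => h.
have {}h : 1 <= K * (2 * a).
  by rewrite -(ler_pM2r (sqn_gt0 v0)) mul1r; apply: le_trans h _; lra.
rewrite -[leLHS]mul1r ler_pdivrMr; lra.
Qed.

Lemma eigenvalue_laplacian0 : (0 < n)%N -> eigenvalue L 0.
Proof.
move=> n0; apply/eigenvalueP; exists (const_mx 1).
  rewrite scale0r; apply/rowP => j; rewrite [RHS]mxE -(laplacian_row j) mxE.
  by apply: eq_bigr => i _; rewrite [const_mx _ _ _]mxE mul1r -[in LHS]laplacian_sym mxE.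
by apply/eqP => /rowP/(_ (Ordinal n0)); rewrite !mxE => /eqP; rewrite oner_eq0.
Qed.

Lemma graph_chi_le d K : (0 < n)%N ->
  (forall i, (#|[set j | adj i j]%SET| <= d)%N) ->
  (forall x, \sum_j x 0 j = 0 -> sqn x <= K * energy x) -> 0 < K ->
  graph_chi R E <= 4 * d%:R * K.
Proof.
move=> n0 deg PK K0; rewrite /graph_chi /lambda_max /lambda_min_pos.
have max_le : sup [set a | eigenvalue L a] <= 2 * d%:R.
  apply: ge_sup; first by exists 0; exact: eigenvalue_laplacian0.
  by move=> a; exact: eigenvalue_laplacian_le.
set S := [set a | _ /\ _]; have [[a Sa]|S0] := pselect (S !=set0); last first.
  (* Without nonzero eigenvalues the infimum is 0 by convention, and so is the quotient. *)
  rewrite (_ : S = set0) ?inf0 ?invr0 ?mulr0; last exact/nonemptyPn.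
  by rewrite !mulr_ge0 // ltW.
have min_ge : (2 * K)^-1 <= inf S.
  apply: lb_le_inf; first by exists a.
  by move=> c [La c0]; exact: eigenvalue_laplacian_ge La c0.
have K20 : 0 < (2 * K)^-1 by rewrite invr_gt0; lra.
have inf0 : 0 < inf S by exact: lt_le_trans min_ge.
rewrite ler_pdivrMr //; apply: le_trans max_le _.
have := ler_wpM2l (_ : 0 <= 4 * d%:R * K) min_ge.
move=> /(_ (mulr_ge0 (mulr_ge0 _ _) (ltW K0)))/= => /(_ (ler0n _ 4) (ler0n _ _)).
by apply: le_trans; rewrite le_eqVlt; apply/orP; left; apply/eqP; field; lra.
Qed.

Lemma graph_chi_ge d K x i k :
  (forall i, (#|[set j | adj i j]%SET| <= d)%N) ->
  (forall x, \sum_j x 0 j = 0 -> sqn x <= K * energy x) -> 0 < K ->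
  ~~ adj i i -> adj i k ->
  x != 0 -> \sum_j x 0 j = 0 -> energy x <= 8 -> 4 < n%:R * sqn x ->
  sqn x / 4 <= graph_chi R E.
Proof.
move=> deg PK K0 /negPf ii ik x0 sx ex nx.
(* The Rayleigh quotient of [- L] at the basis vector of [i] is minus the degree of [i], hence at
   most -1. *)
have max_ge : 1 <= sup [set a | eigenvalue L a].
  have Ns : (- L)^T = - L by rewrite linearN /= laplacian_sym.
  have e0 : delta_mx 0 i != 0 :> 'rV[R]_n.
    by apply/eqP => /rowP/(_ i); rewrite !mxE !eqxx => /eqP; rewrite oner_eq0.
  have [a /eigenvalueP[v vL v0]] := rayleigh_eigenvalue Ns e0.
  have -> : sqn (delta_mx 0 i : 'rV[R]_n) = 1.
    rewrite /sqn (bigD1 i) //= !mxE !eqxx expr1n big1 ?addr0 // => j /negPf ji.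
    by rewrite !mxE ji andbF expr0n.
  rewrite bilinE (bigD1 i) //= [X in _ + X]big1 => [|j /negPf ji]; last first.
    by rewrite [X in _ * X]mxE ji andbF mulr0.
  rewrite (bigD1 i) //= big1 => [|j /negPf ji]; last by rewrite mxE ji andbF mul0r.
  rewrite !mxE !eqxx !addr0 !mulr1 mul1r => a1.
  have : 1 <= - a.
    have := laplacianE i i; rewrite eqxx mul1r !mxE eqxx => e.
    rewrite e in a1; move: a1.
    rewrite ii (bigD1 k) //= ik subr0 /= => a1.
    have : 0 <= \sum_(j | j != k) (adj i j)%:R :> R by exact: sumr_ge0.
    by lra.
  move=> /le_trans; apply; apply: sup_upper_bound.
    split; first by exists 0; apply: eigenvalue_laplacian0; exact: leq_trans (ltn_ord i).
    by exists (2 * d%:R) => c; exact: eigenvalue_laplacian_le.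
  apply/eigenvalueP; exists v => //.
  by rewrite scaleNr -vL mulmxN opprK.
(* Adding the all-ones matrix moves the eigenvalue of the constants from 0 to [n]. An eigenvalue of
   [L + J] below [n] then has an eigenvector of zero sum, so it belongs to [L] and is nonzero by the
   Poincare inequality. *)
pose J : 'M[R]_n := const_mx 1.
have JE (y : 'rV[R]_n) j : (y *m J) 0 j = \sum_i y 0 i.
  by rewrite mxE; apply: eq_bigr => m _; rewrite mxE mulr1.
have Bs : (L + J)^T = L + J by rewrite linearD /= laplacian_sym trmx_const.
have [a /eigenvalueP[v vB v0] a_le] := rayleigh_eigenvalue Bs x0.
have {}a_le : a * sqn x <= 4.
  apply: le_trans a_le _; rewrite /bilin mulmxDr mulmxDl mxE -/(bilin L x x).
  rewrite [X in _ + X](_ : _ = 0); first by move: ex; rewrite energyE; lra.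
  by rewrite mxE big1 // => j _; rewrite JE sx mul0r.
have sv : \sum_j v 0 j = 0.
  have e : \sum_j (v *m (L + J)) 0 j = n%:R * \sum_j v 0 j.
    under eq_bigr => j _ do rewrite mulmxDr mxE JE.
    rewrite big_split /= sumr_const card_ord [X in X + _](_ : _ = 0) ?add0r ?mulr_natl //.
    under eq_bigr => j _ do rewrite mxE.
    rewrite exchange_big /= big1 // => m _.
    by rewrite -mulr_sumr laplacian_row mulr0.
  have : (n%:R - a) * \sum_j v 0 j = 0.
    by rewrite mulrBl -e vB mulr_sumr -sumrB big1 // => j _; rewrite mxE subrr.
  move/eqP; rewrite mulf_eq0 => /orP[/eqP na|/eqP //].
  by have := sqn_gt0 x0; move: a_le; rewrite -(subr0_eq na); lra.
have vL : v *m L = a *: v.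
  have vJ : v *m J = 0 by apply/rowP => j; rewrite JE sv mxE.
  by rewrite -vB (mulmxDr v L J) vJ addr0.
have a0 : a != 0.
  apply/eqP => a0; have := PK v sv; rewrite energyE (bilin_eigen vL) a0 mul0r !mulr0.
  by rewrite leNgt sqn_gt0.
have aS : [set a | eigenvalue L a /\ a != 0] a by split=> //; apply/eigenvalueP; exists v.
have lbS : lbound [set a | eigenvalue L a /\ a != 0] (2 * K)^-1.
  by move=> c [Lc c0]; exact: eigenvalue_laplacian_ge Lc c0.
have min_gt : 0 < lambda_min_pos R E.
  apply: lt_le_trans (lb_le_inf _ lbS); last by exists a.
  by rewrite invr_gt0; lra.
have min_le : lambda_min_pos R E <= a by apply: ge_inf aS; exists (2 * K)^-1.
rewrite /graph_chi ler_pdivlMr //; apply: le_trans max_ge.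
have := ler_wpM2l (sqn_ge0 x) min_le; lra.
Qed.

End Laplacian.

(** * Poincare inequality for two heaps *)

Section Poincare.
Variable R : realType.

(** Cauchy-Schwarz along the path of parents from [i] to the root, whose length is the logarithm;
    the sum over the path is enlarged to all indices up to [i]. *)
Lemma heap_path (y : nat -> R) i : (y i - y 0%N) ^+ 2 <=
  (trunc_log 2 i.+1)%:R * \sum_(1 <= j < i.+1) (y j - y j.-1./2) ^+ 2.
Proof.
elim/ltn_ind: i => -[_|i IH].
  by rewrite subrr expr0n mulr_ge0 // sumr_ge0 // => *; exact: sqr_ge0.
have pi : (i./2 < i.+1)%N by lia.
have {IH} := IH _ pi; set s := (X in _ <= _ * X) => IH.
rewrite trunc_log2S // (_ : i.+2./2 = (i./2).+1)%N //.
rewrite [X in _ * X]big_nat_recr //=.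
have s_le : s <= \sum_(1 <= j < i.+1) (y j - y j.-1./2) ^+ 2.
  rewrite /s [leRHS](big_cat_nat (n := i./2.+1)) //= lerDl.
  by apply: sumr_ge0 => j _; exact: sqr_ge0.
have s0 : 0 <= s by apply: sumr_ge0 => j _; exact: sqr_ge0.
set d : R := (trunc_log 2 _)%:R in IH *.
have d0 : 0 <= d by [].
rewrite -natr1 -/d.
apply: (@le_trans _ _ ((d + 1) * (s + (y i.+1 - y i./2) ^+ 2))); last first.
  by rewrite ler_wpM2l ?addr_ge0 // lerD2r.
rewrite (_ : y i.+1 - y 0%N = (y i.+1 - y i./2) + (y i./2 - y 0%N)); last by ring.
move: (y i.+1 - _) (y i./2 - _) IH => a c.
have [->|dN0] := eqVneq d 0.
  rewrite mul0r add0r mul1r => c0.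
  have -> : c = 0 by apply/eqP; rewrite -sqrf_eq0 eq_le c0 sqr_ge0.
  by rewrite addr0 lerDr.
have dp : 0 < d by rewrite lt_neqAle eq_sym dN0.
(* [(a + c) ^ 2 <= (d + 1) (a ^ 2 + c ^ 2 / d)] *)
move=> cd; rewrite -subr_ge0 -(pmulr_rge0 _ dp).
have := sqr_ge0 (d * a - c); have : 0 <= (d + 1) * (d * s - c ^+ 2).
  by rewrite mulr_ge0 ?subr_ge0 //; lra.
lra.
Qed.

Variables (N b : nat).
Hypothesis bN : (b < N)%N.
Local Notation G := (two_heaps N b).
Local Notation adj := (@Defs.adjacent N.+1 G).
Variable x : 'rV[R]_N.+1.
Local Notation W := (energy G x).
Local Notation D := (trunc_log 2 N.+1).

(** Each index [k] owns an ordered pair starting at [sigma k], so no term of the energy is used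
    twice. The left heap takes the identity for [sigma], the right heap the reversal. *)
Lemma edge_sum_le (sigma : 'I_N.+1 -> 'I_N.+1) (F : nat -> R) m :
  injective sigma -> (m <= N.+1)%N ->
  (forall k : 'I_N.+1, (0 < k < m)%N ->
     exists2 i, adj (sigma k) i & F k = (x 0 (sigma k) - x 0 i) ^+ 2) ->
  \sum_(1 <= k < m) F k <= W.
Proof.
move=> sinj mN Fe.
rewrite big_geq_mkord (big_ord_widen_cond N.+1 (leq 1) F mN) big_mkcond /=.
rewrite /energy [leRHS](reindex_inj sinj) /=; apply: ler_sum => k _.
have W0 i j : 0 <= (adj i j)%:R * (x 0 i - x 0 j) ^+ 2 by rewrite mulr_ge0 ?sqr_ge0.
case: ifP => [/Fe[i ki ->]|_]; last by apply: sumr_ge0.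
by rewrite (bigD1 i) //= ki mul1r lerDl sumr_ge0.
Qed.

Lemma left_heap_le i : (i <= b)%N ->
  (x 0 (inord i) - x 0 (inord 0)) ^+ 2 <= D%:R * W.
Proof.
move=> ib; apply: le_trans (heap_path (fun k => x 0 (inord k)) i) _.
apply: ler_pM => //.
- by apply: sumr_ge0 => k _; exact: sqr_ge0.
- by rewrite ler_nat leq_trunc_log //; lia.
apply: (@edge_sum_le id) => // [|k /andP[k0 ki]]; first by lia.
exists (inord k.-1./2); last by rewrite inord_val.
rewrite adjacent_two_heaps inordK; last by have := ltn_ord k; lia.
by rewrite /= heap_edge_left ?orbT //; lia.
Qed.

Lemma right_heap_le i : (b < i <= N)%N ->
  (x 0 (inord i) - x 0 (inord N)) ^+ 2 <= D%:R * W.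
Proof.
move=> /andP[ib iN].
have := heap_path (fun k => x 0 (inord (N - k))) (N - i).
rewrite subn0 subKn // => /le_trans; apply.
apply: ler_pM => //.
- by apply: sumr_ge0 => k _; exact: sqr_ge0.
- by rewrite ler_nat leq_trunc_log //; lia.
apply: (@edge_sum_le (@rev_ord N.+1)) => [||k /andP[k0 ki]]; [exact: rev_ord_inj|lia|].
exists (inord (N - k.-1./2)).
  rewrite adjacent_two_heaps inordK /= ?subSS; last by have := ltn_ord k; lia.
  by rewrite heap_edge_right ?orbT //; lia.
congr ((x 0 _ - x 0 _) ^+ 2); apply/val_inj => /=; rewrite inordK ?subSS //; lia.
Qed.

Lemma bridge_le : (x 0 (inord b) - x 0 (inord b.+1)) ^+ 2 <= W.
Proof.
have e : Defs.adjacent G (inord b) (inord b.+1).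
  by rewrite adjacent_two_heaps !inordK ?heap_edge_bridge ?orbT //; lia.
rewrite /energy (bigD1 (inord b)) //= (bigD1 (inord b.+1)) //= e mul1r -addrA lerDl.
by rewrite addr_ge0 // ?sumr_ge0 // => *; rewrite ?sumr_ge0 // => *; rewrite mulr_ge0 ?sqr_ge0.
Qed.

Lemma poincare_two_heaps : \sum_j x 0 j = 0 -> sqn x <= 16 * N.+1%:R * D%:R * W.
Proof.
move=> sx; have W0 : 0 <= W := energy_ge0 G x.
have D1 : 1 <= D%:R :> R by rewrite ler1n trunc_log_gt0 /=; lia.
have WD : W <= D%:R * W by have := ler_wpM2r W0 D1; rewrite mul1r.
(* A vertex of the right heap reaches 0 through [N], [b.+1] and [b]: four pieces, each with square
   at most [D%:R * W]. The six squares below yield the inequality bounding the square of a sum of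
   four terms by four times the sum of their squares. *)
have far i : (x 0 i - x 0 (inord 0)) ^+ 2 <= 16 * (D%:R * W).
  rewrite -(inord_val i); have iN := ltn_ord i; move: (nat_of_ord i) iN => {}i iN.
  have [ib|ib] := leqP i b; first by apply: le_trans (left_heap_le ib) _; lra.
  have := left_heap_le (leqnn b); have := bridge_le.
  have := @right_heap_le b.+1; have := @right_heap_le i.
  move=> /(_ _)/[!ib] /(_ iN) h1 /(_ _)/[!ltnSn] /(_ bN) h2 h3 h4.
  move: (x 0 (inord 0)) (x 0 (inord b)) (x 0 (inord b.+1)) (x 0 (inord N))
    (x 0 (inord i)) h1 h2 h3 h4.
  move: (D%:R * W) (W) WD => K W' WK c0 cb cb1 cN ci h1 h2 h3 h4.
  have := sqr_ge0 ((ci - cN) + (cb1 - cN)).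
  have := sqr_ge0 ((ci - cN) + (cb - cb1)).
  have := sqr_ge0 ((ci - cN) - (cb - c0)).
  have := sqr_ge0 ((cb1 - cN) - (cb - cb1)).
  have := sqr_ge0 ((cb1 - cN) + (cb - c0)).
  have := sqr_ge0 ((cb - cb1) + (cb - c0)).
  lra.
have : \sum_i (x 0 i - x 0 (inord 0)) ^+ 2 <= N.+1%:R * (16 * (D%:R * W)).
  rewrite mulr_natl -[X in _ *+ X]card_ord -sumr_const.
  exact: ler_sum.
have -> : \sum_i (x 0 i - x 0 (inord 0)) ^+ 2 = sqn x + N.+1%:R * x 0 (inord 0) ^+ 2.
  rewrite (eq_bigr (fun i =>
    x 0 i ^+ 2 + x 0 (inord 0) ^+ 2 - 2 * x 0 (inord 0) * x 0 i));
    last by move=> i _; ring.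
  by rewrite sumrB big_split /= sumr_const card_ord -mulr_sumr sx mulr0 subr0 mulr_natl.
have : 0 <= N.+1%:R * x 0 (inord 0) ^+ 2 by rewrite mulr_ge0 ?sqr_ge0.
lra.
Qed.

End Poincare.

(** * Condition numbers *)

Section Chi.
Variable R : realType.

(** Here [512 = 4 * 8 * 16], from the degree bound 8 and the Poincare constant. *)
Lemma graph_chi_two_heaps_le N b : (b < N)%N ->
  graph_chi R (two_heaps N b) <= 512 * N.+1%:R * (trunc_log 2 N.+1)%:R.
Proof.
move=> bN; have D1 : 1 <= (trunc_log 2 N.+1)%:R :> R by rewrite ler1n trunc_log_gt0 /=; lia.
have K0 : 0 < 16 * N.+1%:R * (trunc_log 2 N.+1)%:R :> R by rewrite !mulr_gt0 //; lra.
have := graph_chi_le (@adjacent_sym N b) (ltn0Sn N) (@two_heaps_degree N b)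
  (poincare_two_heaps bN) K0.
lra.
Qed.

(** Test with the vector equal to 1 on one half and -1 on the other: its squared norm is [4 * M],
    and the bridge alone gives energy [2 * 4 = 8]. *)
Lemma graph_chi_two_heaps_ge M : (0 < M)%N ->
  M%:R <= graph_chi R (two_heaps (4 * M).-1 (2 * M).-1).
Proof.
move=> M0; set N := (4 * M).-1; set b := (2 * M).-1.
have bN : (b < N)%N by rewrite /b /N; lia.
have NE : N.+1 = (4 * M)%N by rewrite /N; lia.
have D1 : 1 <= (trunc_log 2 N.+1)%:R :> R by rewrite ler1n trunc_log_gt0 /=; lia.
have K0 : 0 < 16 * N.+1%:R * (trunc_log 2 N.+1)%:R :> R by rewrite !mulr_gt0 //; lra.
have M1 : 1 <= M%:R :> R by rewrite ler1n.
pose x : 'rV[R]_N.+1 := \row_i (if (i <= b)%N then 1 else -1).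
have sx : sqn x = 4 * M%:R.
  rewrite /sqn (eq_bigr (fun=> 1)); first by rewrite sumr_const card_ord NE natrM.
  by move=> i _; rewrite mxE; case: ifP; rewrite ?sqrrN expr1n.
have x0 : x != 0.
  by apply/eqP => x0; move: sx; rewrite x0 /sqn big1 => [|i _]; [lra|rewrite mxE expr0n].
have sumx : \sum_j x 0 j = 0.
  have e : (2 * M + 2 * M = N.+1)%N by lia.
  rewrite (eq_bigr (fun j : 'I_N.+1 => if (j <= b)%N then 1 else -1)) => [|j _];
    last by rewrite mxE.
  rewrite -(big_mkord xpredT (fun j => if (j <= b)%N then 1 else -1 : R)) -e.
  rewrite (big_cat_nat (n := 2 * M)) //=; last by lia.
  rewrite (eq_big_nat _ _ (F2 := fun=> 1)) => [|j jM];
    last by rewrite (_ : (j <= b)%N) // /b; lia.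
  rewrite [X in _ + X](eq_big_nat _ _ (F2 := fun=> -1)) => [|j jM]; last first.
    by rewrite (_ : (j <= b)%N = false) // /b; lia.
  by rewrite !sumr_const_nat addnK subn0 mulNrn subrr.
have ex : energy (two_heaps N b) x <= 8.
  pose c (i j : 'I_N.+1) : R := (i == inord b)%:R * (j == inord b.+1)%:R.
  have sc : \sum_i \sum_j c i j = 1.
    rewrite (bigD1 (inord b)) //= (bigD1 (inord b.+1)) //= /c !eqxx mulr1 !big1 ?addr0 //.
      by move=> i /negPf ->; rewrite big1 // => j _; rewrite mul0r.
    by move=> j /negPf ->; rewrite mulr0.
  have : energy (two_heaps N b) x <= \sum_i \sum_j (4 * c i j + 4 * c j i).
    apply: ler_sum => i _; apply: ler_sum => j _.
    have c0 k l : 0 <= c k l by rewrite mulr_ge0.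
    rewrite adjacent_two_heaps.
    have [/heap_edge_side h|_] := boolP (_ || _); last first.
      by rewrite mul0r addr_ge0 // mulr_ge0.
    rewrite mul1r !mxE; case: h => [->|[ib jb]|[ib jb]].
    - by rewrite subrr expr0n addr_ge0 // mulr_ge0.
    - rewrite ib jb leqnn ltnn; have -> : c i j = 1.
        by rewrite /c -jb -ib !inord_val !eqxx mulr1.
      by have := c0 j i; lra.
    - rewrite ib jb leqnn ltnn; have -> : c j i = 1.
        by rewrite /c -ib -jb !inord_val !eqxx mulr1.
      by have := c0 i j; lra.
  clearbody c.
  under eq_bigr => i _ do rewrite big_split -!mulr_sumr /=.
  by rewrite big_split /= -!mulr_sumr [X in _ + 4 * X]exchange_big /= sc; lra.
have N1 : (1 < N.+1)%N by lia.
have := @graph_chi_ge _ _ _ (@adjacent_sym N b) 8 _ x ord0 (Ordinal N1)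
  (@two_heaps_degree N b) (poincare_two_heaps bN) K0 _ _ x0 sumx ex.
rewrite sx; have -> : 4 * M%:R / 4 = M%:R :> R by field.
apply.
- rewrite adjacent_two_heaps orbb; apply/negP => /heap_edge_neq; exact: negP.
- by rewrite adjacent_two_heaps (@heap_edge_left _ _ 1) ?orbT //= /b; lia.
- by rewrite NE natrM; nra.
Qed.

Lemma trunc_log2_le n : (0 < n)%N -> (trunc_log 2 n)%:R * ln 2 <= ln n%:R :> R.
Proof.
move=> n0; rewrite mulr_natl -lnXn // ler_ln ?posrE ?exprn_gt0 ?ltr0n //.
by rewrite -natrX ler_nat trunc_logP.
Qed.

(** The inequality [ln (1 + y) <= y] at [y = -1/2]. *)
Lemma ln2_ge : 1 / 2 <= ln 2 :> R.
Proof.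
have := @le_ln1Dx R (- (1 / 2)).
rewrite (_ : 1 + - (1 / 2) = 2^-1); last by field.
rewrite lnV ?posrE // => /(_ _); lra.
Qed.

(** For [n >= 16], [n / 4] is at least the square root of [n], so [ln chi] is at least half of
    [ln n]. The binary logarithm is at most [2 * ln n], whence [2048 = 512 * 2 * 2]. *)
Lemma chi_over_ln_le (chi : R) n : (16 <= n)%N -> n%:R / 4 <= chi ->
  chi <= 512 * n%:R * (trunc_log 2 n)%:R -> chi / ln chi <= 2048 * n%:R.
Proof.
move=> n16 chi_ge chi_le.
have nR : 16 <= n%:R :> R by rewrite ler_nat.
have ln_n : 0 < ln n%:R :> R by rewrite ln_gt0; lra.
have D_le : (trunc_log 2 n)%:R <= 2 * ln n%:R :> R.
  have := @trunc_log2_le n; have := ln2_ge; have : 0 <= (trunc_log 2 n)%:R :> R by [].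
  move=> D0 l2 /(_ _) h; have {}h := h (leq_trans _ n16).
  by have := ler_wpM2l D0 l2; have := h isT; lra.
have ln_chi : ln n%:R / 2 <= ln chi.
  rewrite ler_pdivrMr // mulr_natr -lnXn; last by lra.
  rewrite ler_ln ?posrE; [|lra|by rewrite exprn_gt0 //; lra].
  apply: (@le_trans _ _ ((n%:R / 4) ^+ 2)); first by nra.
  by rewrite ler_pXn2r ?nnegrE //; lra.
have ln_chi0 : 0 < ln chi by lra.
rewrite ler_pdivrMr //; apply: le_trans chi_le _.
have n0 : 0 <= 512 * n%:R :> R by lra.
apply: le_trans (ler_wpM2l n0 D_le) _.
have n1 : 0 <= 2048 * n%:R :> R by lra.
by have := ler_wpM2l n1 ln_chi; lra.
Qed.

End Chi.

(** * The hard problem *)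

Section HardProblem.
Variables (R : realType) (N : nat) (mu t : R).
Hypotheses (N1 : (1 < N)%N) (mu0 : 0 <= mu) (t0 : 0 <= t).
Local Notation H := (ell2 R).

(* The factor [N.+1] cancels the averaging in the global function. *)
Let s : R := N.+1%:R * t.
Let s0 : 0 <= s. Proof. by rewrite mulr_ge0. Qed.

Definition node_weight (i : nat) : R := if (i == 0)%N || (i == N) then s else 0.

Definition node_fun (i : 'I_N.+1) : H -> R :=
  local_fun mu (node_weight i) (i == 0 :> nat)%N
    ((if (i == 0 :> nat)%N then s else 0) *: delta_seq R 0).

Lemma node_weight_ge0 i : 0 <= node_weight i.
Proof. by rewrite /node_weight; case: ifP. Qed.

Lemma node_fun_lipschitz i : exists Li : R, smooth Li (node_fun i).
Proof. by eexists; apply: local_fun_smooth; rewrite ?node_weight_ge0. Qed.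

Lemma node_fun_convex i : convex_function [set: H] (node_fun i : H -> R^o).
Proof. by apply: local_fun_convex; rewrite ?node_weight_ge0. Qed.

Let N0 : (0 < N)%N. Proof. exact: ltnW. Qed.

Definition hard_problem : decentralized_problem R :=
  @DecentralizedProblem R N.+1 (fun q => two_heaps N (bridge N q)) node_fun
    (fun q => @two_heaps_simple N (bridge N q))
    (fun q => two_heaps_connected (bridge_lt q N0)) node_fun_convex node_fun_lipschitz.

Lemma global_hard_problem :
  global_fun hard_problem = quadratic (chain_op mu t) (t *: delta_seq R 0).
Proof.
apply/funext => x; rewrite /global_fun /=.
have first_fun : node_fun ord0 x =
    mu / 2 * dot x x + s / 2 * dot (x - swap true x) x - s * x 0%N.
  rewrite /node_fun /local_fun /quadratic /local_op /node_weight /=.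
  by rewrite eqxx !(@dotDl R, @dotZl R) dot_delta_seq; field.
have last_fun : node_fun ord_max x =
    mu / 2 * dot x x + s / 2 * dot (x - swap false x) x.
  rewrite /node_fun /local_fun /quadratic /local_op /node_weight /= eqxx orbT.
  rewrite (_ : (N == 0)%N = false); last by lia.
  by rewrite !(@dotDl R, @dotZl R); field.
have mid_fun (i : 'I_N.+1) : i != ord0 -> i != ord_max ->
    node_fun i x = mu / 2 * dot x x.
  rewrite -!(inj_eq val_inj) /= => /negPf i0 /negPf iN.
  rewrite /node_fun /local_fun /quadratic /local_op /node_weight i0 iN /=.
  by rewrite !(@dotDl R, @dotZl R); field.
have sumE : \sum_(i < N.+1) node_fun i x = N.+1%:R * (mu / 2 * dot x x) +
    s / 2 * (dot (x - swap true x) x + dot (x - swap false x) x) - s * x 0%N.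
  have NE : ord_max != ord0 :> 'I_N.+1 by rewrite -(inj_eq val_inj) /=; lia.
  have -> : N.+1%:R * (mu / 2 * dot x x) = \sum_(i < N.+1) (mu / 2 * dot x x).
    by rewrite sumr_const card_ord mulr_natl.
  rewrite (bigD1 ord0) //= (bigD1 ord_max) //= [in RHS](bigD1 ord0) //=.
  rewrite [in RHS](bigD1 ord_max) //= first_fun last_fun.
  rewrite (eq_bigr (fun=> mu / 2 * dot x x)); first ring.
  by move=> i /andP[i0 iN]; exact: mid_fun.
rewrite sumE /quadratic chain_op_split (@dotZl R) dot_delta_seq /s.
have : N.+1%:R != 0 :> R by rewrite pnatr_eq0.
move: (N.+1%:R : R) => n n0; field; exact: n0.
Qed.

Lemma node_fun_flip q i x :
  node_fun i (flip (level N q i) x) = node_fun i x.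
Proof.
apply: local_fun_flip.
  rewrite /node_weight; have [i0|i0] /= := eqVneq (i : nat) 0%N.
    by right; rewrite i0 level_first.
  have [iN|iN] := eqVneq (i : nat) N; last by left.
  by right; rewrite iN (negPf (level_last _ N0)).
(* The linear term sits at node 0, whose level is odd and hence positive, so coordinate 0 lies below
   the boundary. *)
apply: coords_below_flip => n ni; rewrite ell2ZE.
case: eqP => [i0|_]; last by rewrite mul0r.
have := level_first q N0; rewrite -[X in level _ _ X]i0 => lo.
rewrite (_ : delta_seq R 0 n = 0) ?mulr0 //=.
by case: n ni lo => //; rewrite leqn0 => /eqP ->.
Qed.

(** Local steps keep the invariant because each node function is invariant under the reflection at
    the node's level; communication keeps it by [level_adjacent]. *)
Lemma hard_memory (A : algorithm hard_problem) k i :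
  alg_mem A i k `<=` coords_below (level N (comm_rounds (alg_step A) k) i).
Proof.
elim: k i => [|k IH] i.
  by rewrite alg_mem0 => _ -> n _.
apply: (classical_sets.subset_trans (@alg_memS _ _ A k i)).
rewrite /comm_rounds big_ord_recr /= -/(comm_rounds (alg_step A) k).
case: (alg_step A k) => /=.
  rewrite addn0; apply: coords_below_lspan => z [x /IH xm].
  case=> [->//|/gradient_coords_below|/egradient_coords_below]; apply => //.
    exact: node_fun_flip.
  exact: node_fun_flip.
rewrite addn1; apply: coords_below_lspan => z [j /= ij /IH].
apply: coords_below_le; apply: level_adjacent => //.
  by rewrite -ltnS.
by rewrite -adjacent_two_heaps; case: ij => [->|]; [left|right].
Qed.

Lemma hard_Delta : dp_Delta hard_problem <= 4.
Proof.
apply: ge_sup; first by exists (edge_changes hard_problem 0)%:R, 0%N.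
move=> _ [q _ <-]; rewrite ler_nat /edge_changes /=.
case: (bridgeS q N0) => ->.
- by rewrite finset.setDv finset.setU0 cards0.
- exact: two_heaps_changes.
- by rewrite finset.setUC two_heaps_changes.
Qed.

Lemma hard_chi_le : dp_chi hard_problem <= 512 * N.+1%:R * (trunc_log 2 N.+1)%:R.
Proof.
apply: ge_sup; first by exists (graph_chi R (dp_edges hard_problem 0)), 0%N.
by move=> _ [q _ <-]; apply: graph_chi_two_heaps_le; exact: bridge_lt.
Qed.

Lemma hard_chi_ge M : N = (4 * M).-1 -> M%:R <= dp_chi hard_problem.
Proof.
move=> NM; have M0 : (0 < M)%N by lia.
apply: le_trans (graph_chi_two_heaps_ge R M0) _.
apply: sup_upper_bound; first exact: dp_chi_has_sup.
have bN : ((2 * M).-1 < N)%N by lia.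
(* In this round of the first sweep the bridge stands in the middle. *)
exists (2 * M).-1 => //=; rewrite /bridge divn_small // modn_small //=.
by rewrite NM.
Qed.

End HardProblem.

(** * The lower bound on communication rounds *)

Lemma rounds_bound (R : realType) (N q : nat) (C k eps : R) : (0 < N)%N ->
  C <= 2048 * N.+1%:R -> 10 < k -> 0 < eps -> eps < expR (- 32) ->
  rate k ^+ (2 * (q %/ N).+2) <= eps ->
  1 / 256 / 256 * (C * Num.sqrt k * ln (1 / eps)) <= q%:R.
Proof.
move=> N0 C_le k10 eps0 eps_small /(rate_dist k10 eps0) h.
have k1 : 1 <= Num.sqrt k by rewrite -sqrtr1 ler_wsqrtr //; lra.
have l32 : 32 <= ln (1 / eps).
  rewrite div1r lnV ?posrE // lerNr -[leRHS]expRK ler_ln ?posrE ?expR_gt0 //.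
  exact: ltW.
have big : 32 <= Num.sqrt k * ln (1 / eps).
  have l0 : 0 <= ln (1 / eps) by lra.
  by have := ler_wpM2r l0 k1; lra.
have q_le : N%:R * (q %/ N)%:R <= q%:R :> R by rewrite -natrM ler_nat mulnC leq_divM.
(* The additive 16 hidden in [8 * (q %/ N).+2] is at most half of the left side, by the choice of
   [expR (- 32)]. *)
have h2 : Num.sqrt k * ln (1 / eps) <= 16 * (q %/ N)%:R.
  by move: h; rewrite -!natr1; lra.
have NR : 0 <= N%:R :> R by [].
have N2 : N.+1%:R <= 2 * N%:R :> R.
  by rewrite -natrM ler_nat mul2n -addnn -addn1 leq_add2l.
have C_le2 : C <= 4096 * N%:R by lra.
have big0 : 0 <= Num.sqrt k * ln (1 / eps) by lra.
(* The factors multiply to [4096 * 16 = 256 * 256]. *)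
have := ler_wpM2r big0 C_le2.
by have := ler_wpM2l NR h2; lra.
Qed.

Theorem corollary3p4 (R : realType) :
  exists2 c : R, 0 < c &
    forall L mu : R, 0 < mu -> mu <= L -> 10 * mu < L ->
    forall (chi0 : R) (n0 : nat),
    exists P : decentralized_problem R,
      [/\ smooth L (global_fun P), strongly_convex mu (global_fun P),
          chi0 < dp_chi P, (n0 < dp_n P)%N
        & dp_Delta P <= 12 * (ln (dp_n P)%:R / ln 2)] /\
      exists2 xstar : ell2 R, is_minimizer (global_fun P) xstar &
        \forall eps \near 0^'+,
          forall (A : algorithm P) (k : nat) (i : 'I_(dp_n P)) (x : ell2 R),
            alg_mem A i k x -> `|x - xstar| ^+ 2 <= eps ->
            c * (dp_chi P / ln (dp_chi P) * Num.sqrt (L / mu) * ln (1 / eps))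
              <= (comm_rounds (alg_step A) k)%:R.
Proof.
exists (1 / 256 / 256); first by lra.
move=> L mu mu0 muL L10 chi0 n0.
(* With [4 * M] vertices a bridge can cut the graph into equal halves, forcing [chi >= M]; [4 <= M]
   gives the 16 vertices required by [chi_over_ln_le]. *)
have [M [M4 Mn Mchi]] : exists M, [/\ (4 <= M)%N, (n0 <= M)%N & chi0 < M%:R].
  exists ((Num.truncn (Num.max chi0 0%R)).+1 + n0 + 4)%N; split.
  - exact: leq_addl.
  - by rewrite -addnA addnCA leq_addr.
  - apply: (@le_lt_trans _ _ (Num.max chi0 0)); first by rewrite le_max lexx.
    by apply: lt_le_trans (truncnS_gt _) _; rewrite ler_nat -addnA leq_addr.
have [N NE] : exists N, N.+1 = (4 * M)%N by exists (4 * M).-1; lia.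
have N1 : (1 < N)%N by lia.
have n0N : (n0 < N.+1)%N by lia.
have N0 : (0 < N)%N by exact: ltnW.
(* Chosen so that the norm bound [mu + 4 * t] of the chain operator is [L]. *)
pose t := (L - mu) / 4.
have t0 : 0 <= t by rewrite /t; lra.
pose P := hard_problem N1 (ltW mu0) t0; exists P.
have chi_ge : M%:R <= dp_chi P by apply: hard_chi_ge; lia.
have chi_ln : dp_chi P / ln (dp_chi P) <= 2048 * N.+1%:R.
  have N16 : (16 <= N.+1)%N by lia.
  have N4 : N.+1%:R / 4 <= dp_chi P by rewrite NE natrM mulrAC divff // mul1r.
  exact: (chi_over_ln_le N16 N4 (hard_chi_le N1 (ltW mu0) t0)).
have gP : global_fun P = quadratic (chain_op mu t) (t *: delta_seq R 0).
  exact: global_hard_problem.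
have opN x : `|chain_op mu t x| <= L * `|x|.
  by rewrite [X in X * _](_ : _ = mu + 4 * t);
    [apply: chain_op_norm => //; exact: ltW|rewrite /t; lra].
have opmu x : mu * `|x| ^+ 2 <= dot (chain_op mu t x) x by exact: chain_op_ge.
split; first split.
- rewrite gP; apply: quadratic_smooth opN; [exact: chain_op_linear|exact: chain_op_sym].
- rewrite gP; apply: quadratic_strongly_convex opN opmu.
    exact: chain_op_linear.
  exact: chain_op_sym.
- exact: lt_le_trans chi_ge.
- exact: n0N.
- apply: le_trans (hard_Delta N1 (ltW mu0) t0) _.
  have : 1 <= ln (dp_n P)%:R / ln 2 :> R; last lra.
  have ln2 := ln2_ge R.
  rewrite ler_pdivlMr ?mul1r; last by lra.
  by rewrite ler_ln ?posrE ?ltr0n ?ler_nat //=; lia.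
have k10 : 10 < L / mu by rewrite ltr_pdivlMr.
have /andP[q0 q1] := rate_bounds k10.
exists (Ell2 (geometric_subproof (ltW q0) q1)).
  rewrite gP; apply: quadratic_minimizer.
  - exact: chain_op_linear.
  - exact: chain_op_sym.
  - by move=> v; apply: le_trans (opmu v); rewrite mulr_ge0 ?sqr_ge0 // ltW.
  - apply: chain_op_geometric; rewrite /t.
    have : mu * (4 * rate (L / mu)) = (L - mu) * (1 - rate (L / mu)) ^+ 2.
      by rewrite rate_eq //; field; rewrite gt_eqF.
    lra.
near=> eps; move=> A k i x Akx x_eps.
set Q := comm_rounds _ _.
have eps0 : 0 < eps by near: eps; exact: nbhs_right_gt.
have eps_small : eps < expR (- 32).
  by near: eps; apply: nbhs_right_lt; exact: expR_gt0.
have xQ : coords_below (Q %/ N).+1 x.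
  by apply: (coords_below_le _ (hard_memory Akx)); exact: level_le.
have dist := le_trans (geometric_dist (ltW q0) q1 xQ) x_eps.
exact: (rounds_bound N0 chi_ln k10 eps0 eps_small dist).
Unshelve. all: by end_near. Qed.
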